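(* Let $k\ge0$ be an integer and let $c_1,\dots,c_k\in\Omega_1(G)$ be such that the subspace $H=\{\alpha\in\operatorname{im} d:(\alpha,c_1)=\dots=(\alpha,c_k)=0\}$ has dimension $|V|-1-k$; set $\mathsf c=c_1\wedge\dots\wedge c_k$. Let $Q=J^1_{\underline 1}(Z_1(G)\otimes\mathbb K)\subseteq\Omega^1(G)$, endowed with the untwisted inner product $\langle\cdot,\cdot\rangle_{\underline 1}$, let $p:\Omega^1(G)\to Q$ be the orthogonal projection on $Q$ with respect to the untwisted inner product, let $\pi_{\mathsf c}:\Omega^1(G)\to\mathbb K^k$, $\alpha\mapsto((\alpha,c_1),\dots,(\alpha,c_k))$, and let $b=p+\pi_{\mathsf c}:\Omega^1(G)\to Q\oplus\mathbb K^k$ (orthogonal direct sum, $\mathbb K^k$ with its usual inner product). Let $b^*$ be the adjoint of $b$, where $\Omega^1(G)$ is endowed with the inner product $\langle\cdot,\cdot\rangle_{\underline x}$. Then $$A_k(\mathsf c,\underline x)=T(\underline x)\,\big\|(\Pi^{\operatorname{im} d}J^1_{\underline x})^{\wedge k}(\mathsf c)\big\|^2=T(\underline 1)\,\underline x^{E}\det(bb^* ),$$ where $A_k(\mathsf c,\underline x)=\sum_{F\in\mathcal F_k(G)}|(\det\mathscr B^F,\mathsf c)|^2\,\underline x^F$ and $T(\underline x)=\sum_{T\in\mathcal T(G)}\underline x^T$.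
   Context: Let $\mathbb K=\mathbb R$ or $\mathbb C$. $G=(V,E)$ is a finite connected graph: $V$ is a finite set of vertices and $E$ a finite set of oriented edges, with source and target maps $s,t:E\to V$ and a fixed-point-free involution $e\mapsto e^{-1}$ of $E$ exchanging source and target. $E^+\subset E$ is a fixed subset containing exactly one element of each pair $\{e,e^{-1}\}$. Positive weights $\underline x=(x_e)_{e\in E}$ with $x_{e^{-1}}=x_e$ are given, and $\underline x^A=\prod_{e\in (A\cup A^{-1})\cap E^+}x_e$ for $A\subseteq E$ (so $\underline x^E=\prod_{e\in E^+}x_e$); $\underline 1$ denotes the weights all equal to $1$. A subgraph of $G$ is a subset $S\subseteq E$ stable under $e\mapsto e^{-1}$, seen as the graph $(V,S)$. $\mathcal T(G)$ is the set of spanning trees of $G$; $\mathcal F_k(G)$ is the set of acyclic (spanning) subgraphs with $k+1$ connected components. $C_1(G)$ is the free abelian group on $E$ modulo $e+e^{-1}=0$; $\partial e=t(e)-s(e)$ in the free abelian group on $V$; $Z_1(G)=\ker\partial$. $C^1(G)=\mathrm{Hom}(C_1(G),\mathbb Z)$, with basis $(e^\star)_{e\in E^+}$ dual to $E^+$. $\delta$ sends $f:V\to\mathbb Z$ to $\delta f\in C^1(G)$, $\delta f(e)=f(t(e))-f(s(e))$; $B^1(G)=\operatorname{im}\delta$; $B^1(G,F)$ is the subgroup of elements of $B^1(G)$ vanishing on the edges of $F$. $\Omega_1(G)=C_1(G)\otimes\mathbb K$, $\Omega^1(G)=C^1(G)\otimes\mathbb K$, $\Omega^0(G)=\mathbb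 K^V$, $d=\delta\otimes\mathrm{id}:\Omega^0(G)\to\Omega^1(G)$, and $(\alpha,c)=\alpha(c)$. $\Omega^1(G)$ carries the inner product $\langle\alpha,\beta\rangle=\langle\alpha,\beta\rangle_{\underline x}=\sum_{e\in E^+}x_e\overline{\alpha(e)}\beta(e)$; the untwisted inner product is the one with all $x_e=1$. $J^1_{\underline x}:\Omega_1(G)\to\Omega^1(G)$ is the antilinear isomorphism with $J^1_{\underline x}(e)=x_e^{-1}e^\star$. $\Pi^{\operatorname{im} d}$ is the orthogonal projection on $\operatorname{im} d$ for $\langle\cdot,\cdot\rangle_{\underline x}$; the norm on $\bigwedge^k\Omega^1(G)$ comes from $\langle u_1\wedge\dots\wedge u_k,v_1\wedge\dots\wedge v_k\rangle=\det(\langle u_i,v_j\rangle_{\underline x})$, and $(\Pi^{\operatorname{im} d}J^1_{\underline x})^{\wedge k}(\mathsf c)=\Pi^{\operatorname{im} d}J^1_{\underline x}c_1\wedge\dots\wedge\Pi^{\operatorname{im} d}J^1_{\underline x}c_k$. For $F\in\mathcal F_k(G)$, $\mathscr B^F=(\beta_1,\dots,\beta_k)$ is any $\mathbb Z$-basis of $B^1(G,F)$ and $|(\det\mathscr B^F,\mathsf c)|^2=|\det(\beta_i(c_j))_{1\le i,j\le k}|^2$. *)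

(* Defs.v *)
From HB Require Import structures.
From mathcomp Require Import all_boot all_order all_algebra.
From mathcomp Require Import boolp reals.
From mathcomp Require Import complex.

Set Implicit Arguments.
Unset Strict Implicit.
Unset Printing Implicit Defensive.

Import Order.TTheory GRing.Theory Num.Theory.

Local Open Scope ring_scope.
Local Open Scope complex_scope.

(* [real_or_complex R conj] says that the field K is either the field R of real
   numbers or R[i], and that conj : K -> K is its conjugation. *)
Variant real_or_complex (R : realType) :
    forall K : numFieldType, (K -> K) -> Prop :=
  | RealScalars : @real_or_complex R R (fun z => z)
  | ComplexScalars : @real_or_complex R R[i] (@conjc R).

(* Finite graphs with oriented edges.  Loops and multiple edges are allowed;
   [epos] is the set E^+, which contains exactly one of e and e^-1. *)
Record graph := Graph {
  vertex : finType;
  edge : finType;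
  src : edge -> vertex;
  tgt : edge -> vertex;
  einv : edge -> edge;
  epos : {set edge};
  einvK : involutive einv;
  einv_neq : forall e, einv e != e;
  src_einv : forall e, src (einv e) = tgt e;
  tgt_einv : forall e, tgt (einv e) = src e;
  epos_einv : forall e, (einv e \in epos) = (e \notin epos)
}.

Arguments src {g}.
Arguments tgt {g}.
Arguments einv {g}.
Arguments epos {g}.

Section Subgraphs.
Variable G : graph.
Implicit Types S : {set edge G}.

Definition is_subgraph S := [forall e in S, einv e \in S].

Definition adj S : rel (vertex G) :=
  [rel u v | [exists e in S, (src e == u) && (tgt e == v)]].

Definition connected S :=
  (0 < #|vertex G|)%N && [forall u, forall v, connect (adj S) u v].

Definition components S : nat := n_comp (adj S) [pred v : vertex G | true].

(* A closed path e_1, ..., e_n (n >= 1) in (V, S), passing through each vertex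
   at most once and never containing an edge together with its inverse.  The
   last condition only matters for n = 2, where it excludes e, e^-1. *)
Definition is_circuit S (p : seq (edge G)) :=
  [&& p != [::], all (mem S) p, cycle [rel e f | tgt e == src f] p,
      uniq (map src p) & all (fun e => einv e \notin p) p].

Definition acyclic S : Prop := forall p : seq (edge G), ~~ is_circuit S p.

Definition spanning_trees : {set {set edge G}} :=
  [set S | [&& is_subgraph S, `[< acyclic S >] & connected S]].

Definition forests (k : nat) : {set {set edge G}} :=
  [set S | [&& is_subgraph S, `[< acyclic S >] & components S == k.+1]].

End Subgraphs.

Section Chains.
Variable G : graph.

Definition posedge := {e : edge G | e \in epos}.

(* C_1(G) is free on E^+ (with e^-1 = - e), so chains and cochains are given by
   their coordinates in the bases E^+ and (e^star)_{e in E^+}. *)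
Definition chain (A : zmodType) := {ffun posedge -> A}.
Definition cochain (A : zmodType) := {ffun posedge -> A}.

Definition boundary (A : zmodType) (c : chain A) :
    {ffun vertex G -> A} :=
  [ffun v => \sum_(e : posedge | tgt (val e) == v) c e
           - \sum_(e : posedge | src (val e) == v) c e].

Definition coboundary (A : zmodType) (f : {ffun vertex G -> A}) :
    cochain A :=
  [ffun e => f (tgt (val e)) - f (src (val e))].

(* B^1(G, F).  As F is stable under inversion, it is enough to test the
   vanishing on the edges of F that belong to E^+. *)
Definition B1rel (F : {set edge G}) (a : cochain int) : Prop :=
  (exists f : {ffun vertex G -> int}, a = coboundary f) /\
  (forall e : posedge, val e \in F -> a e = 0).

Definition is_Zbasis (k : nat) (B : cochain int -> Prop)
    (beta : 'I_k -> cochain int) : Prop :=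
  (forall i, B (beta i)) /\
  (forall a, B a -> exists! n : {ffun 'I_k -> int},
     a = \sum_(i < k) beta i *~ n i).

End Chains.

Section Scalars.
Variables (G : graph) (K : numFieldType) (conj : K -> K).

Definition Omega_0 := {ffun vertex G -> K^o}.
Definition Omega_1 := chain G K^o.
Definition Omega1 := cochain G K^o.
Implicit Types (x : edge G -> K) (a b : Omega1) (c : Omega_1).

Definition pairing a c : K := \sum_e a e * c e.

Definition weight x (A : {set edge G}) : K :=
  \prod_(e in (A :|: einv @: A) :&: epos) x e.

Definition unit_weight : edge G -> K := fun=> 1.

Definition inner x a b : K := \sum_e x (val e) * conj (a e) * b e.

Lemma coboundary_is_linear : linear (@coboundary G K^o : Omega_0 -> Omega1).
Proof.
by move=> l f g; apply/ffunP=> e; rewrite !ffunE scalerBr opprD addrACA.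
Qed.

HB.instance Definition _ :=
  GRing.isLinear.Build K Omega_0 Omega1 _ (@coboundary G K^o)
    coboundary_is_linear.

Lemma boundary_is_linear : linear (@boundary G K^o : Omega_1 -> Omega_0).
Proof.
move=> l f g; apply/ffunP=> v; rewrite !ffunE scalerBr !scaler_sumr.
under eq_bigr do rewrite !ffunE.
under [X in _ - X = _]eq_bigr do rewrite !ffunE.
by rewrite !big_split opprD addrACA.
Qed.

HB.instance Definition _ :=
  GRing.isLinear.Build K Omega_1 Omega_0 _ (@boundary G K^o)
    boundary_is_linear.

Lemma inner_is_linear x a : linear (inner x a : Omega1 -> K^o).
Proof.
move=> l f g; rewrite /inner scaler_sumr -big_split; apply: eq_bigr => e _ /=.
by rewrite !ffunE mulrDr /GRing.scale /= mulrCA.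
Qed.

HB.instance Definition _ x a :=
  GRing.isLinear.Build K Omega1 K^o _ (inner x a) (inner_is_linear x a).

Definition wedge_inner x k (u v : 'I_k -> Omega1) : K :=
  \det (\matrix_(i < k, j < k) inner x (u i) (v j)).

(* Squared norm of u_1 /\ ... /\ u_k; only decomposable k-vectors are needed,
   so the exterior power itself is not constructed. *)
Definition wedge_normsq x k (u : 'I_k -> Omega1) : K := wedge_inner x u u.

Definition J1 x c : Omega1 := [ffun e => conj (c e) / x (val e)].

Definition im_d : {vspace Omega1} :=
  limg (linfun (@coboundary G K^o : Omega_0 -> Omega1)).

(* Z_1(G) (x) K, as the kernel of the K-linear extension of the boundary. *)
Definition Z1K : {vspace Omega_1} :=
  lker (linfun (@boundary G K^o : Omega_1 -> Omega_0)).

(* J1 is antilinear, so the image of a subspace is the span of the image of one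
   of its bases. *)
Definition Qspace : {vspace Omega1} :=
  <<[seq J1 unit_weight z | z <- vbasis Z1K]>>%VS.

Definition inner_basis x (U : {vspace Omega1}) (a : Omega1) : 'rV[K]_(\dim U) :=
  \row_i inner x (vbasis U)`_i a.

Lemma inner_basis_is_linear x U : linear (inner_basis x U).
Proof. by move=> l f g; apply/rowP=> i; rewrite !mxE linearP. Qed.

HB.instance Definition _ x U :=
  GRing.isLinear.Build K Omega1 'rV[K]_(\dim U) _ (inner_basis x U)
    (inner_basis_is_linear x U).

Definition orthc x (U : {vspace Omega1}) : {vspace Omega1} :=
  lker (linfun (inner_basis x U)).

(* Orthogonal projection on U: the projection on U along its orthogonal. *)
Definition orth_proj x (U : {vspace Omega1}) : 'End(Omega1) :=
  daddv_pi U (orthc x U).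

Definition pi_c k (c : 'I_k -> Omega_1) (a : Omega1) : 'rV[K]_k :=
  \row_i pairing a (c i).

Lemma pi_c_is_linear k (c : 'I_k -> Omega_1) : linear (pi_c c).
Proof.
move=> l f g; apply/rowP=> i; rewrite !mxE /pairing mulr_sumr -big_split.
by apply: eq_bigr => e _ /=; rewrite !ffunE mulrDl -mulrA.
Qed.

HB.instance Definition _ k (c : 'I_k -> Omega_1) :=
  GRing.isLinear.Build K Omega1 'rV[K]_k _ (pi_c c) (pi_c_is_linear c).

Definition Hspace k (c : 'I_k -> Omega_1) : {vspace Omega1} :=
  (im_d :&: lker (linfun (pi_c c)))%VS.

Definition QKk k := (subvs_of Qspace * 'rV[K]_k)%type.

Definition inner_QKk k (u v : QKk k) : K :=
  inner unit_weight (vsval u.1) (vsval v.1)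
  + \sum_(i < k) conj (u.2 0 i) * v.2 0 i.

Definition b_fun k (c : 'I_k -> Omega_1) (a : Omega1) : QKk k :=
  (vsproj Qspace (orth_proj unit_weight Qspace a), pi_c c a).

Lemma b_fun_is_linear k (c : 'I_k -> Omega_1) : linear (b_fun c).
Proof. by move=> l f g; rewrite /b_fun !linearP. Qed.

HB.instance Definition _ k (c : 'I_k -> Omega_1) :=
  GRing.isLinear.Build K Omega1 (QKk k) _ (b_fun c) (b_fun_is_linear c).

Definition b_map k (c : 'I_k -> Omega_1) : 'Hom(Omega1, QKk k) :=
  linfun (b_fun c).

Definition is_adjoint x k (f : 'Hom(Omega1, QKk k)) (g : 'Hom(QKk k, Omega1)) :=
  forall a u, inner_QKk (f a) u = inner x a (g u).

Definition detE (W : vectType K) (f : 'End(W)) : K :=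
  \det (passmx.mxof (vbasis {:W}) (vbasis {:W}) f).

Definition tree_sum x : K := \sum_(T in spanning_trees G) weight x T.

(* |(det B^F, c)|^2 *)
Definition det_normsq k (beta : 'I_k -> cochain G int) (c : 'I_k -> Omega_1) : K :=
  `| \det (\matrix_(i < k, j < k)
       pairing ([ffun e => (beta i e)%:~R] : Omega1) (c j)) | ^+ 2.

(* A_k(c, x), computed with the Z-basis beta F of B^1(G, F) for each F. *)
Definition forest_sum k (beta : {set edge G} -> 'I_k -> cochain G int)
    (c : 'I_k -> Omega_1) x : K :=
  \sum_(F in forests G k) det_normsq (beta F) c * weight x F.

End Scalars.

Arguments unit_weight : clear implicits.

(* Main.v *)
From HB Require Import structures.
Require Import Defs.
From mathcomp Require Import all_boot all_order all_algebra.
From mathcomp Require Import reals.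
From mathcomp Require Import all_fingroup boolp complex ring.

(* Fix a root v0 and let D be the incidence matrix of G with the column of v0
   removed, C the matrix with columns c_1, ..., c_k, U = C^T D and
   X = diag(x_e).  With the reduced Laplacian L = D^T X D, all three
   expressions equal det L * det (U L^-1 U^* ).
   - Expanding the bordered determinant of L by Cauchy-Binet gives a sum over
     sets of |V| - 1 - k edges of x^F |det [U; D_F]|^2.  A circuit in F is a
     relation between the rows of D_F; if F is a forest, D_F has an integral
     right inverse which, together with a Z-basis of B^1(G, F), forms a
     unimodular matrix, and det [U; D_F] = +- det (beta_i(c_j)).  For k = 0 this
     is the matrix-tree theorem T(x) = det L.
   - The Gram matrix of the projections of J c_i on im d = im D is U L^-1 U^*,
     up to conjugation.
   - If the columns of q form a basis of Q, then b b^* has determinant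
     det ([q^*; C^T] X^-1 [q, conj C]) / det (q^* q); a Schur complement
     and the duality between the minors of X on im D and of X^-1 on its
     orthogonal im q turn this into the same expression. *)

Import Order.TTheory GRing.Theory Num.Theory.
Local Open Scope ring_scope.

Set Implicit Arguments.
Unset Strict Implicit.
Unset Printing Implicit Defensive.

(** * Determinants *)

Section CauchyBinet.
Variables (R : comNzRingType) (P : finType) (n : nat).
Implicit Types A B : P -> 'I_n -> R.

Lemma det_sum_rows A B :
  \det (\matrix_(i, j) \sum_p A p i * B p j) =
  \sum_(f : {ffun 'I_n -> P})
    (\prod_i A (f i) i) * \det (\matrix_(i, j) B (f i) j).
Proof.
rewrite /determinant.
under [RHS]eq_bigr do rewrite mulr_sumr.
rewrite exchange_big /=; apply: eq_bigr => s _.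
under eq_bigr do rewrite mxE.
rewrite bigA_distr_bigA /= mulr_sumr; apply: eq_bigr => f _.
rewrite big_split /= mulrCA; congr (_ * (_ * _)).
by apply: eq_bigr => i _; rewrite mxE.
Qed.

(* The sum runs over families rather than subsets of P, so that every n-subset
   is counted n`! times. *)
Lemma cauchy_binet A B :
  \sum_(f : {ffun 'I_n -> P})
     \det (\matrix_(i, j) A (f i) j) * \det (\matrix_(i, j) B (f i) j) =
  \det (\matrix_(i, j) \sum_p A p i * B p j) *+ n`!.
Proof.
(* Composing [f] with s permutes the rows of the B-minor and costs the sign of s. Summing these n!
   equal expressions over s assembles the Leibniz expansion of the A-minor. *)
have E (s : 'S_n) : \det (\matrix_(i, j) \sum_p A p i * B p j) =
  \sum_(f : {ffun 'I_n -> P}) (-1) ^+ s * (\prod_i A (f (s i)) i)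
       * \det (\matrix_(i, j) B (f i) j).
  rewrite det_sum_rows.
  rewrite (reindex_inj (h := fun f : {ffun 'I_n -> P} => [ffun i => f (s i)])).
    apply: eq_bigr => f _; rewrite [in RHS]mulrAC [RHS]mulrC; congr (_ * _).
      by apply: eq_bigr => i _; rewrite ffunE.
    rewrite -det_perm -det_mulmx; congr (\det _).
    by rewrite -row_permE; apply/matrixP=> i j; rewrite !mxE ffunE.
  move=> f g /ffunP E; apply/ffunP=> i.
  by have := E (s^-1 i)%g; rewrite !ffunE permKV.
rewrite -card_Sn -sumr_const.
under [RHS]eq_bigr => s _ do rewrite (E s).
rewrite [RHS]exchange_big /=; apply: eq_bigr => f _.
rewrite -mulr_suml; congr (_ * _).
rewrite -det_tr; apply: eq_bigr => s _; congr (_ * _).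
by apply: eq_bigr => i _; rewrite !mxE.
Qed.

End CauchyBinet.

(** * Bordered determinants, complementary minors and Schur complements *)

Section Bordered.
Variable K : fieldType.

(** The rank factorisation of A is [col_ebase] times [pid_mx] times [row_ebase]; undoing the last
    factor leaves columns that vanish beyond the k-th, whatever the rank of A. *)
Lemma exists_unit_rsubmx0 k s (A : 'M[K]_(k, k + s)) :
  exists2 g : 'M_(k + s), g \in unitmx & rsubmx (A *m g) = 0.
Proof.
exists (invmx (row_ebase A)); first by rewrite unitmx_inv row_ebase_unit.
rewrite -[A in A *m _]mulmx_ebase mulmxK ?row_ebase_unit //.
suff E : rsubmx (pid_mx (\rank A) : 'M[K]_(k, k + s)) = 0.
  by rewrite -mulmx_rsub E mulmx0.
apply/matrixP=> i j; rewrite !mxE /=.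
by rewrite (_ : (i == k + j :> nat) = false) // ltn_eqF // ltn_addr.
Qed.

(* Jacobi's identity for complementary minors of a matrix and its inverse. *)
Lemma det_ulsubmx_invmx k s (L : 'M[K]_(k + s)) : L \in unitmx ->
  \det L * \det (ulsubmx (invmx L)) = \det (drsubmx L).
Proof.
move=> Lu; have := mulmxV Lu.
rewrite -{1}(submxK L) -{1}(submxK (invmx L)) mulmx_block scalar_mx_block.
case/eq_block_mx=> E1 _ E3 _.
transitivity (\det (L *m block_mx (ulsubmx (invmx L)) 0 (dlsubmx (invmx L))
  1%:M)).
  by rewrite det_mulmx det_lblock det1 mulr1.
rewrite -{1}(submxK L) mulmx_block !mulmx0 !mulmx1 !add0r E1 E3.
by rewrite det_ublock det1 mul1r.
Qed.

(** Column changes g and h that clear the last s columns of U and V make the bordered matrices block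
    triangular, so each determinant is a constant times an s-minor. Cauchy-Binet sums these minors
    to that of the lower right block of [L'], which is L in the new bases. Jacobi's identity trades
    it for the upper left minor of the inverse, which is that of U L^-1 V^T up to the constants. *)
Lemma bordered_cauchy_binet (P : finType) k s (A B : P -> 'I_(k + s) -> K)
    (U V : 'M[K]_(k, k + s)) (L := \matrix_(i, j) \sum_p A p i * B p j) :
  L \in unitmx ->
  \sum_(f : {ffun 'I_s -> P})
    \det (col_mx V (\matrix_(i, j) A (f i) j))
    * \det (col_mx U (\matrix_(i, j) B (f i) j)) =
  \det L * \det (U *m invmx L *m V^T) *+ s`!.
Proof.
move=> Lu.
have [g gu gU] := exists_unit_rsubmx0 U; have [h hu hV] := exists_unit_rsubmx0 V.
pose Bg p j := \sum_i B p i * g i (rshift k j).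
pose Ah p j := \sum_i A p i * h i (rshift k j).
have rowsE (A' : P -> 'I_(k + s) -> K) (W : 'M_(k, k + s)) (t : 'M_(k + s))
    (f : {ffun 'I_s -> P}) : rsubmx (W *m t) = 0 ->
  \det (col_mx W (\matrix_(i, j) A' (f i) j)) * \det t =
  \det (lsubmx (W *m t)) *
  \det (\matrix_(i, j) \sum_l A' (f i) l * t l (rshift k j)).
  move=> W0; rewrite -det_mulmx mul_col_mx -(hsubmxK (W *m t)) W0.
  set M := (X in col_mx _ X); rewrite -(hsubmxK M) -/(block_mx _ _ _ _).
  rewrite row_mxKl det_lblock; congr (_ * \det _).
  apply/matrixP=> i j; rewrite !mxE; apply: eq_bigr => l _.
  by rewrite !mxE.
have ghu : \det h * \det g != 0.
  by rewrite mulf_neq0 // -unitfE -unitmxE.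
apply: (mulIf ghu); rewrite mulr_suml.
under eq_bigr => f _.
  rewrite mulrACA (rowsE _ _ _ _ hV) (rowsE _ _ _ _ gU) mulrACA; over.
rewrite -mulr_sumr (cauchy_binet Ah Bg) mulrnAr mulrnAl; congr (_ *+ _).
pose L' := h^T *m L *m g.
have L'u : L' \in unitmx by rewrite !unitmx_mul unitmx_tr hu Lu.
have -> : \matrix_(i, j) \sum_p Ah p i * Bg p j = drsubmx L'.
  apply/matrixP=> i j; rewrite !mxE.
  transitivity (\sum_p \sum_a \sum_b A p a * h a (rshift k i) * (B p b *
    g b (rshift k j))).
    apply: eq_bigr => p _; rewrite mulr_suml; apply: eq_bigr => a _.
    by rewrite mulr_sumr.
  rewrite exchange_big /=.
  under [RHS]eq_bigr do rewrite mxE mulr_suml.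
  rewrite [RHS]exchange_big /=; apply: eq_bigr => a _.
  rewrite exchange_big /=; apply: eq_bigr => b _.
  rewrite !mxE mulr_sumr mulr_suml; apply: eq_bigr => p _; ring.
rewrite -(det_ulsubmx_invmx L'u).
have -> : U *m invmx L *m V^T =
   lsubmx (U *m g) *m ulsubmx (invmx L') *m (lsubmx (V *m h))^T.
  have -> : invmx L = g *m invmx L' *m h^T.
    have /mulmx1C hL : h^T *m (L *m g *m invmx L') = 1%:M.
      by rewrite !mulmxA -/L' mulmxV.
    by rewrite -[LHS]mulmx1 -hL !mulmxA mulVmx // mul1mx.
  rewrite !mulmxA -(mulmxA _ h^T) -trmx_mul.
  rewrite -{1}(hsubmxK (U *m g)) -{1}(hsubmxK (V *m h)) gU hV.
  rewrite -{1}(submxK (invmx L')) mul_row_block tr_row_mx mul_row_col.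
  by rewrite trmx0 mulmx0 !mul0mx !addr0.
rewrite !det_mulmx !det_tr; ring.
Qed.

(** With E' = [q'; D'] and E = [q, X D], both E' E and E' X^-1 E are block triangular; comparing
    determinants relates Q = q' X^-1 q to L = D' X D. Eliminating Q from the bordered matrix then
    leaves the Schur complement C' D L^-1 D' C. *)
Lemma det_schur_dual m l r k (q : 'M[K]_(m, l)) (q' : 'M_(l, m))
    (D : 'M_(m, r)) (D' : 'M_(r, m)) (X : 'M_m) (C : 'M_(m, k))
    (C' : 'M_(k, m)) :
  (l + r = m)%N -> q' *m D = 0 -> D' *m q = 0 -> X \in unitmx ->
  q' *m invmx X *m q \in unitmx -> D' *m X *m D \in unitmx ->
  \det (D' *m D) * \det X *
    \det (col_mx q' C' *m invmx X *m row_mx q C) =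
  \det (q' *m q) * (\det (D' *m X *m D) *
    \det (C' *m D *m invmx (D' *m X *m D) *m (D' *m C))).
Proof.
move=> Em; case: m / Em q q' D D' X C C' => q q' D D' X C C'.
move=> qD Dq Xu qXqu Lu.
set L := D' *m X *m D in Lu *; set Q := q' *m invmx X *m q in qXqu *.
pose E' := col_mx q' D'; pose E := row_mx q (X *m D).
have E'E : E' *m E = block_mx (q' *m q) (q' *m X *m D) 0 L.
  by rewrite mul_col_row Dq !mulmxA.
have E'XE : E' *m invmx X *m E = block_mx Q 0 (D' *m invmx X *m q) (D' *m D).
  rewrite mul_col_mx mul_col_row -!mulmxA (mulKmx Xu) qD.
  by rewrite !mulmxA.
have detE1 := congr1 determinant E'E.
have detE2 := congr1 determinant E'XE.
rewrite det_mulmx det_ublock in detE1.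
rewrite !det_mulmx det_inv det_lblock in detE2.
have dX : \det X != 0 by rewrite -unitfE -unitmxE.
have dets : \det (D' *m D) * \det X * \det Q = \det (q' *m q) * \det L.
  rewrite -detE1 mulrAC [\det _ * \det Q]mulrC -detE2 mulrAC -!mulrA;
    congr (_ * _).
  by rewrite mulKf.
(* X^-1 splits into a piece carried by q and a piece carried by D, as is checked after left
   multiplication by the invertible matrix [q'; D' X]. *)
have XE : invmx X = invmx X *m q *m invmx Q *m q' *m invmx X +
  D *m invmx L *m D'.
  have E2u : col_mx q' (D' *m X) \in unitmx.
    have : col_mx q' (D' *m X) *m row_mx (invmx X *m q) D \in unitmx.
      rewrite mul_col_row qD !mulmxA (mulmxK Xu) Dq -/Q -/L unitmxE det_lblock.
      by rewrite unitrM -!unitmxE qXqu Lu.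
    by rewrite unitmx_mul => /andP[].
  apply: (can_inj (mulKmx E2u)); rewrite mulmxDr !mulmxA !mul_col_mx add_col_mx.
  rewrite -/Q mulmxV // mul1mx qD !mul0mx addr0 mulmxK //.
  rewrite -/L mulmxV // mul1mx Dq !mul0mx add0r.
  by [].
transitivity (\det (D' *m D) * \det X * (\det Q *
  \det (C' *m D *m invmx L *m (D' *m C)))).
  congr (_ * _).
  pose G := block_mx 1%:M (- (invmx Q *m q' *m invmx X *m C)) 0 1%:M.
  have G1 : \det G = 1 by rewrite det_ublock !det1 mul1r.
  rewrite -[LHS]mulr1 -G1 -det_mulmx mul_col_mx mul_col_row mulmx_block.
  rewrite !mulmx0 !mulmx1 !addr0 !mulmxN !mulmxA -/Q mulmxV // mul1mx addNr.
  rewrite det_lblock; congr (_ * \det _).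
  have := congr1 (fun Z => C' *m Z *m C) XE.
  by rewrite mulmxDr mulmxDl !mulmxA => ->; rewrite addKr.
by rewrite !mulrA dets.
Qed.

End Bordered.

(** * Forests and potentials *)

Section Forests.
Variable G : graph.
Implicit Types (S F : {set edge G}) (e : edge G) (u v : vertex G).

Lemma adjP S u v :
  reflect (exists2 e, e \in S & src e = u /\ tgt e = v) (adj S u v).
Proof.
apply: (iffP existsP) => [[e /and3P[eS /eqP <- /eqP <-]]|[e eS [<- <-]]].
  by exists e.
by exists e; rewrite eS !eqxx.
Qed.

Lemma connect_const (T : eqType) (h : vertex G -> T) S u v :
  {in S, forall e, h (src e) = h (tgt e)} -> connect (adj S) u v -> h u = h v.
Proof.
move=> hS /connectP[p]; elim: p u => [u _ -> //|w p IHp u /= /andP[uw pw] E].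
by case/adjP: uw (IHp _ pw E) => e eS [<- <-] <-; apply: hS.
Qed.

Lemma adj_sym S : is_subgraph S -> symmetric (adj S).
Proof.
move=> /'forall_implyP Si.
suff h u v : adj S u v -> adj S v u by move=> u v; apply/idP/idP; apply: h.
case/adjP=> e eS [<- <-]; apply/adjP; exists (einv e); first exact: Si.
by rewrite src_einv tgt_einv.
Qed.

Lemma subgraph_connect_sym S : is_subgraph S -> connect_sym (adj S).
Proof. by move=> Ss; apply/sym_connect_sym/adj_sym. Qed.

Lemma walk_of_path S e p : path (adj S) (tgt e) p ->
  exists2 q : seq (edge G), {subset q <= S} &
    path [rel e f | tgt e == src f] e q /\ map tgt q = p.
Proof.
elim: p e => [|w p IHp] e /=; first by exists [::].
case/andP=> /adjP[f fS [Ef <-]] /IHp[q qS [qP <-]].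
exists (f :: q) => [g|]; first by rewrite inE => /orP[/eqP->|/qS].
by rewrite /= Ef eqxx.
Qed.

Lemma walk_src e q :
  path [rel e f | tgt e == src f] e q -> map src q = belast (tgt e) (map tgt q).
Proof. by elim: q e => [//|g q IHq] e /= /andP[/eqP-> /IHq->]. Qed.

(** The inverse of the first edge of q ends at the starting vertex [tgt e], which a walk with
    distinct vertices never reaches again; induction along q excludes the other pairs. *)
Lemma walk_no_backtrack e q :
  path [rel e f | tgt e == src f] e q -> uniq (tgt e :: map tgt q) ->
  {in q, forall f, einv f \notin q}.
Proof.
elim: q e => [|g q IHq] e //= /andP[/eqP Eg gq] /and3P[eq gNq Uq] f.
have back h : einv h \in q -> h != g.
  by apply: contraTneq => ->; apply: contra eq => /(map_f tgt);
    rewrite tgt_einv Eg inE orbC => ->.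
rewrite !inE => /orP[/eqP->|fq]; rewrite negb_or.
  rewrite einv_neq; apply/negP=> /back; by rewrite eqxx.
rewrite (IHq g) ?gq //= ?gNq // andbT.
apply/eqP=> E; have := back (einv f); rewrite einvK fq E eqxx.
by move/(_ isT).
Qed.

Lemma subgraph_ind S (Q : edge G -> Prop) : is_subgraph S ->
  (forall e, Q e -> Q (einv e)) ->
  (forall p : posedge G, val p \in S -> Q (val p)) ->
  {in S, forall e, Q e}.
Proof.
move=> /'forall_implyP Ss Qi Qp e eS; have [ep|] := boolP (e \in epos).
  exact: (Qp (Sub e ep)).
rewrite -epos_einv => ep; rewrite -(einvK e); apply: Qi.
by apply: (Qp (Sub (einv e) ep)); rewrite SubK Ss.
Qed.

(** A path from [tgt e] to [src e] avoiding e and its inverse can be taken simple, and e closes it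
    to a circuit. For a loop the path is empty. *)
Lemma acyclic_bridge S e : is_subgraph S -> acyclic S -> e \in S ->
  ~~ connect (adj (S :\: [set e; einv e])) (tgt e) (src e).
Proof.
move=> Ss Sa eS; apply/negP=> /connectP[p0 p0P Ep0].
case/shortenP: p0P Ep0 => p pP pU _ Ep.
have [q qS [qP Eq]] := walk_of_path pP.
have qSe f : f \in q -> [/\ f \in S, f != e & f != einv e].
  by move/qS; rewrite !inE negb_or => /andP[/andP[]].
move/negP: (Sa (e :: q)); apply; rewrite /is_circuit /=.
apply/and4P; split.
- by rewrite eS; apply/allP=> f /qSe[].
- rewrite rcons_path qP /=.
  by rewrite Ep -Eq last_map.
- by rewrite (walk_src qP) Eq Ep -rcons_uniq -lastI.
- apply/andP; split.
    rewrite inE negb_or einv_neq; apply/negP=> /qSe[_ _]; by rewrite eqxx.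
  apply/allP=> f fq; rewrite inE negb_or (walk_no_backtrack qP) ?Eq // andbT.
  by apply/eqP=> E; case: (qSe f fq) => _ _; rewrite -E einvK eqxx.
Qed.

(* If e is a bridge of S, this is the indicator of the component of tgt e in
   S minus e, and its coboundary restricted to S is the cochain dual to e. *)
Definition potential (S : {set edge G}) e v : bool :=
  connect (adj (S :\: [set e; einv e])) (tgt e) v.

Lemma potential_coboundary (A : pzRingType) S (p p' : posedge G) :
  is_subgraph S -> acyclic S -> val p \in S -> val p' \in S ->
  (potential S (val p) (tgt (val p')))%:R
  - (potential S (val p) (src (val p')))%:R = (p == p')%:R :> A.
Proof.
move=> Ss Sa pS p'S; have [<-|pp'] := eqVneq p p'.
  by rewrite /potential connect0 (negPf (acyclic_bridge Ss Sa pS)) subr0.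
have Ss' : is_subgraph (S :\: [set val p; einv (val p)]).
  apply/'forall_implyP=> e; rewrite !inE => /andP[Ne eS].
  move/'forall_implyP: Ss => ->//; rewrite andbT.
  by apply: contra Ne => /orP[/eqP<-|/eqP/(can_inj (@einvK G))->];
    rewrite ?einvK eqxx ?orbT.
have pa : adj (S :\: [set val p; einv (val p)]) (src (val p')) (tgt (val p')).
  apply/adjP; exists (val p') => //;
    rewrite !inE p'S andbT negb_or eq_sym pp' /=.
  apply/eqP=> E; have := valP p'.
  by rewrite /= E epos_einv (valP p).
apply/eqP; rewrite subr_eq0; apply/eqP; congr (_%:R); congr nat_of_bool.
rewrite /potential; apply/idP/idP=> h; apply: (connect_trans h);
  apply: connect1 => //.
by rewrite adj_sym.
Qed.

Definition posedges (S : {set edge G}) : {set posedge G} :=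
  [set p | val p \in S].

(* Over 'F_2, a cochain on S and a value at the root of each component come from
   a unique function on the vertices, so 2 ^ (#|S| + components S) = 2 ^ #|V|. *)
Lemma acyclic_card S : is_subgraph S -> acyclic S ->
  (#|posedges S| + components S)%N = #|vertex G|.
Proof.
move=> Ss Sa.
pose W := {ffun vertex G -> 'F_2}.
pose Y := ({ffun {p | p \in posedges S} -> 'F_2} *
          {ffun {v | v \in roots (adj S)} -> 'F_2})%type.
pose phi (f : W) : Y := ([ffun p => f (tgt (val (val p)))
  - f (src (val (val p)))],
   [ffun v => f (val v)]).
have Sc := subgraph_connect_sym Ss.
have phi_inj : injective phi.
  move=> f g [/ffunP E1 /ffunP E2]; apply/ffunP=> v.
  have E : {in S, forall e, f (src e) - g (src e) = f (tgt e) - g (tgt e)}.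
    apply: subgraph_ind => // [e E|p pS]; first by rewrite src_einv tgt_einv.
    have pS' : p \in posedges S by rewrite inE.
    have := E1 (Sub p pS'); rewrite !ffunE /= => Ep; apply/eqP.
    rewrite -subr_eq0; move/eqP: Ep; rewrite -subr_eq0 => /eqP Ep; apply/eqP.
    by rewrite -oppr0 -Ep; ring.
  apply/eqP; rewrite -subr_eq0.
  rewrite (connect_const (h := fun v => f v - g v) E (connect_root _ v)).
  by have := E2 (Sub _ (roots_root Sc v)); rewrite !ffunE /= => ->;
    rewrite subrr.
have phi_surj (y : Y) : exists f, phi f = y.
  pose f0 v := \sum_p y.1 p * (potential S (val (val p)) v)%:R.
  pose R v : {v | v \in roots (adj S)} := Sub _ (roots_root Sc v).
  (* [f0] has the prescribed coboundary on S; adding a function of the root of v, constant on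
     components, adjusts the values at the roots without changing that coboundary. *)
  exists [ffun v => f0 v + (y.2 (R v) - f0 (fingraph.root (adj S) v))].
  rewrite [y]surjective_pairing; congr pair; apply/ffunP.
    move=> p; rewrite !ffunE.
    have pS : val (val p) \in S by have := valP p; rewrite inE.
    have ER : fingraph.root (adj S) (tgt (val (val p)))
      = fingraph.root (adj S) (src (val (val p))).
      apply/(fingraph.rootP Sc); rewrite Sc; apply: connect1; apply/adjP;
        by exists (val (val p)).
    have -> : R (tgt (val (val p))) = R (src (val (val p))) by apply: val_inj.
    rewrite ER opprD addrACA subrr addr0 /f0 -sumrB (bigD1 p) //= -mulrBr.
    rewrite potential_coboundary // eqxx mulr1 big1 ?addr0 // => i ip.
    have iS : val (val i) \in S by have := valP i; rewrite inE.
    by rewrite -mulrBr potential_coboundary // (negPf (ip : val i != val p))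
      mulr0.
  move=> v; rewrite !ffunE.
  have Ev : fingraph.root (adj S) (val v) = val v by apply/eqP; exact: (valP v).
  by rewrite Ev; have -> : R (val v) = v by [apply: val_inj];
    rewrite addrC subrK.
have : #|W| = #|{: Y}|.
  apply: (@bij_eq_card _ _ phi).
  have [psi psiK] := choice phi_surj.
  by exists psi => // f; apply: phi_inj; rewrite psiK.
rewrite card_prod !card_ffun card_Fp // -expnD => /eqP.
rewrite eqn_exp2l // !card_sig => /eqP->; congr addn.
by rewrite /components /n_comp_mem; apply: eq_card => v; rewrite !inE ?andbT.
Qed.
End Forests.

(** * Incidence matrix *)

Section Incidence.
Variable G : graph.
Implicit Types (e : edge G) (v : vertex G).

Definition incid e v : int := (tgt e == v)%:R - (src e == v)%:R.

Lemma incid_einv e v : incid (einv e) v = - incid e v.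
Proof. by rewrite /incid src_einv tgt_einv opprB. Qed.

Lemma sum_incid (A : zmodType) (f : vertex G -> A) e :
  \sum_v f v *~ incid e v = f (tgt e) - f (src e).
Proof.
under eq_bigr do rewrite mulrzBr.
rewrite sumrB; congr (_ - _).
  rewrite (bigD1 (tgt e)) //= eqxx big1 ?addr0 // => v /negPf nv.
  by rewrite eq_sym nv.
rewrite (bigD1 (src e)) //= eqxx big1 ?addr0 // => v /negPf nv.
by rewrite eq_sym nv.
Qed.

Lemma sum_posedge (A : zmodType) (F : edge G -> A) :
  \sum_(p : posedge G) F (val p) = \sum_(e in epos) F e.
Proof. by rewrite (big_sub (fun e => e \in epos)). Qed.

(* The fundamental cycle carried by a circuit, in the coordinates of E^+. *)
Lemma cyclic_relation S : is_subgraph S -> ~ acyclic S ->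
  exists2 y : posedge G -> int, exists p, y p != 0 &
   (forall p, y p != 0 -> val p \in S)
   /\ forall v, \sum_p y p * incid (val p) v = 0.
Proof.
move=> Ss /existsNP[q /negP]; rewrite negbK.
case/and5P=> q0 /allP qS qc qu /allP qi.
pose y (p : posedge G) : int := (val p \in q)%:R - (einv (val p) \in q)%:R.
exists y; last split.
(* As the circuit never contains an edge with its inverse, no cancellation occurs in [y] at its
   first edge. *)
- case: q => // e q in q0 qS qc qu qi y *.
  have eq := mem_head e q; have eiq := qi _ eq.
  have [ep|] := boolP (e \in epos).
    by exists (Sub e ep); rewrite /y SubK eq (negPf eiq).
  rewrite -epos_einv => ep; exists (Sub (einv e) ep).
  by rewrite /y SubK einvK eq (negPf eiq).
- move=> p; rewrite /y; have [/qS //|_] := boolP (val p \in q).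
  have [/qS pS _|] := boolP (einv (val p) \in q); last by rewrite subr0 eqxx.
  by rewrite -[val p]einvK; move/'forall_implyP: Ss; apply.
move=> v; rewrite (sum_posedge (fun e => ((e \in q)%:R - (einv e \in q)%:R) *
  incid e v)).
under eq_bigr do rewrite mulrBl.
rewrite sumrB.
rewrite [X in _ - X](reindex_inj (can_inj (@einvK G))) /=.
under [X in _ - X]eq_bigl do rewrite epos_einv.
under [X in _ - X]eq_bigr do rewrite einvK incid_einv mulrN.
rewrite sumrN opprK.
transitivity (\sum_e (e \in q)%:R * incid e v).
  by rewrite [RHS](bigID (mem epos)).
transitivity (\sum_(e <- q) incid e v).
  rewrite (big_uniq _ (map_uniq qu)) [RHS]big_mkcond; apply: eq_bigr => e _.
  by case: (e \in q); rewrite ?mul1r ?mul0r.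
rewrite /incid sumrB.
(* Along a closed walk the targets are a rotation of the sources, so the boundary telescopes. *)
have E : perm_eq (map tgt q) (map src q).
  case: q qc {q0 qS qu qi y} => //= e q; rewrite rcons_path => /andP[qP /eqP E].
  by rewrite (walk_src qP) -E -last_map lastI perm_rcons.
transitivity (\sum_(w <- map tgt q) (w == v)%:R - \sum_(w <- map src q)
  (w == v)%:R : int).
  by rewrite !big_map.
by rewrite (perm_big _ E) subrr.
Qed.

(** * The incidence matrix with the root [v0] removed; [nu] enumerates the other vertices *)

Variables (r : nat) (v0 : vertex G) (nu : 'I_r -> vertex G).
Hypothesis nu_inj : injective nu.
Hypothesis nu_v0 : forall i, nu i != v0.
Hypothesis nu_surj : forall v, v != v0 -> exists i, nu i = v.

Lemma sum_nu_incid (A : zmodType) (f : vertex G -> A) e : f v0 = 0 ->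
  \sum_j f (nu j) *~ incid e (nu j) = f (tgt e) - f (src e).
Proof.
move=> f0; rewrite -sum_incid (bigID (pred1 v0))
  /= big_pred1_eq f0 mul0rz add0r.
have Ecodom : codom nu =i [pred v | v != v0].
  move=> v; apply/codomP/idP => [[i ->]|/nu_surj[i <-]]; first exact: nu_v0.
  by exists i.
rewrite -(eq_bigl _ _ Ecodom) -big_uniq /=; last first.
  by rewrite map_inj_uniq ?enum_uniq.
by rewrite codomE big_map big_enum.
Qed.

Definition extend0 (A : zmodType) (z : 'I_r -> A) v : A :=
  \sum_(j | nu j == v) z j.

Lemma extend0_nu (A : zmodType) (z : 'I_r -> A) j : extend0 z (nu j) = z j.
Proof.
rewrite /extend0 (bigD1 j) //= big1 ?addr0 // => i /andP[/eqP/nu_inj->].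
by rewrite eqxx.
Qed.

Lemma extend0_v0 (A : zmodType) (z : 'I_r -> A) : extend0 z v0 = 0.
Proof. by rewrite /extend0 big_pred0 // => i; apply/negbTE. Qed.

Lemma sum_incid_extend0 (A : zmodType) (z : 'I_r -> A) e :
  \sum_j z j *~ incid e (nu j) = extend0 z (tgt e) - extend0 z (src e).
Proof.
rewrite -sum_nu_incid ?extend0_v0 //.
by apply: eq_bigr => j _; rewrite extend0_nu.
Qed.

(** The extension of z by 0 at [v0] has zero coboundary, hence is constant on the connected graph,
    and its value at the root is 0. The coefficient group is arbitrary because the lemma serves over
    both the integers and K. *)
Lemma incid_free (A : zmodType) (z : 'I_r -> A) : connected [set: edge G] ->
  (forall p : posedge G, \sum_j z j *~ incid (val p) (nu j) = 0) ->
  forall j, z j = 0.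
Proof.
move=> /andP[_ /'forall_forallP hG] z0 j.
rewrite -(extend0_nu z) -(extend0_v0 z); apply: connect_const (hG _ _).
apply: subgraph_ind => [|e E|p _].
- by apply/'forall_implyP=> e; rewrite !inE.
- by rewrite src_einv tgt_einv.
by apply/eqP; rewrite eq_sym -subr_eq0 -sum_incid_extend0 z0.
Qed.

End Incidence.

Lemma sum_mulmx_int m n (A : 'M[int]_(m, n)) (w : 'cV_n) (q : 'I_m -> int) :
  \sum_j (A *m w) j 0 *~ q j = \sum_l (\sum_j A j l *~ q j) * w l 0.
Proof.
under eq_bigr do rewrite mulrzz mxE mulr_suml.
rewrite exchange_big /=; apply: eq_bigr => l _; rewrite mulr_suml.
by apply: eq_bigr => j _; rewrite mulrzz; ring.
Qed.

(** * Determinants bordered by chains: circuits, forests and unimodularity *)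

Section ForestDet.
Variable G : graph.

Definition sym_edges (S : {set posedge G}) : {set edge G} :=
  [set e | [exists p in S, (e == val p) || (einv e == val p)]].

Lemma sym_edges_subgraph S : is_subgraph (sym_edges S).
Proof.
apply/'forall_implyP=> e; rewrite !inE => /exists_inP[p pS Ep].
by apply/exists_inP; exists p; rewrite // einvK orbC.
Qed.

Lemma sym_edgesK S : posedges (sym_edges S) = S.
Proof.
apply/setP=> p; rewrite !inE; apply/exists_inP/idP => [[p' p'S]|pS].
  case/orP=> [/eqP/val_inj -> //|/eqP E].
  by have := valP p'; rewrite /= -E epos_einv (valP p).
by exists p; rewrite ?eqxx.
Qed.

Lemma posedgesK F : is_subgraph F -> sym_edges (posedges F) = F.
Proof.
move=> Fs; apply/setP=> e; rewrite !inE.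
have Fi e' : (einv e' \in F) = (e' \in F).
  move/'forall_implyP: Fs => Fs; apply/idP/idP => [/Fs|/Fs//].
  by rewrite einvK.
apply/exists_inP/idP => [[p]|eF].
  by rewrite inE => pF /orP[] /eqP E; [rewrite E|rewrite -Fi E].
have [ep|] := boolP (e \in epos).
  by exists (Sub e ep); rewrite ?inE !SubK ?eF ?eqxx.
by rewrite -epos_einv => ep; exists (Sub (einv e) ep);
  rewrite ?inE !SubK ?Fi ?eF ?eqxx ?orbT.
Qed.

Lemma weight_posedges (K : numFieldType) (x : edge G -> K) F : is_subgraph F ->
  weight x F = \prod_(p in posedges F) x (val p).
Proof.
move=> Fs; rewrite /weight.
have -> : F :|: einv @: F = F.
  apply/setUidPl/subsetP=> _ /imsetP[e eF ->].
  by move/'forall_implyP: Fs; apply.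
rewrite [RHS]big_mkcond /=.
under [RHS]eq_bigr do rewrite inE.
rewrite -(big_sub (fun e => e \in epos) (fun e => if e \in F then x e else 1)).
rewrite -big_mkcondr; apply: eq_bigl => e; by rewrite inE andbC.
Qed.

Lemma mem_forests F k :
  (F \in forests G k) = [&& is_subgraph F,
    `[< acyclic F >] & components F == k.+1].
Proof. by rewrite inE. Qed.

Variables (k s : nat) (v0 : vertex G) (nu : 'I_(k + s) -> vertex G).
Hypothesis hG : connected [set: edge G].
Hypothesis nu_inj : injective nu.
Hypothesis nu_v0 : forall i, nu i != v0.
Hypothesis nu_surj : forall v, v != v0 -> exists i, nu i = v.

Lemma card_vertex_nu : #|vertex G| = (k + s).+1.
Proof.
rewrite (cardD1 v0) inE add1n -[in RHS](card_ord (k + s)) -(card_codom nu_inj).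
congr _.+1; apply: eq_card => v; rewrite !inE andbT.
apply/idP/codomP => [/nu_surj[i <-]|[i ->]]; last exact: nu_v0.
by exists i.
Qed.

Section Scalars.
Variables (K : numFieldType) (c : 'I_k -> Omega_1 G K).

Definition incid_row (p : posedge G) (j : 'I_(k + s)) : K :=
  (incid (val p) (nu j))%:~R.

(** Row a holds the coefficients of the boundary of [c a] at the non-root vertices. *)
Definition chain_mx : 'M[K]_(k, k + s) :=
  \matrix_(a, j) \sum_p c a p * incid_row p j.

Section FixedFamily.
Variable f : {ffun 'I_s -> posedge G}.
Let F := sym_edges (f @: setT).
Let M := col_mx chain_mx (\matrix_(i, j) incid_row (f i) j).

Lemma det_noninjective : ~~ injectiveb f -> \det M = 0.
Proof.
case/injectivePn=> i1 [i2 ne E].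
apply: (determinant_alternate (i1 := rshift k i1) (i2 := rshift k i2)).
  by rewrite (inj_eq (@rshift_inj _ _)).
by move=> j; rewrite !col_mxEd !mxE E.
Qed.

Hypothesis f_inj : injective f.

Lemma posedges_family : posedges F = f @: setT.
Proof. exact: sym_edgesK. Qed.

(** By [acyclic_card], an acyclic subgraph with s positive edges has k + 1 components. So F contains
    a circuit, whose coefficients give a linear relation between the rows of M below the border. *)
Lemma det_nonforest : F \notin forests G k -> \det M = 0.
Proof.
have Fs : is_subgraph F by apply: sym_edges_subgraph.
move=> Nf; have Na : ~ acyclic F.
  move=> Fa; move/negP: Nf; apply; rewrite mem_forests Fs.
  have := acyclic_card Fs Fa; rewrite posedges_family card_vertex_nu
    card_imset //.
  rewrite cardsT card_ord addnC -addSn => /addIn ->.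
  by rewrite eqxx andbT; apply/asboolP.
have [y [p0 y0] [yF y_incid]] := cyclic_relation Fs Na.
have f_of p : y p != 0 -> exists i, p = f i.
  move/yF => pF; have : p \in posedges F by rewrite inE.
  by rewrite posedges_family => /imsetP[i _ ->]; exists i.
apply/eqP/det0P; exists (row_mx 0 (\row_i (y (f i))%:~R)).
  have [i Ei] := f_of _ y0.
  apply: contraNneq y0 => /rowP/(_ (rshift k i)); rewrite row_mxEr !mxE -Ei.
  by move/eqP; rewrite intr_eq0.
rewrite mul_row_col mul0mx add0r; apply/rowP=> j; rewrite !mxE.
under eq_bigr do rewrite !mxE -intrM.
rewrite -(rmorph_sum (intr : {rmorphism int -> K}))
  /= -[RHS](rmorph0 (intr : {rmorphism int -> K})).
congr (_%:~R); rewrite -[RHS](y_incid (nu j)).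
rewrite [RHS](bigID (mem (f @: setT))) /= [X in _ + X]big1 ?addr0.
  rewrite big_imset /= => [|? ? _ _ /f_inj//].
  by apply: eq_big => i; rewrite ?inE.
move=> p Np; have [->|/f_of[i E]] := eqVneq (y p) 0; first by rewrite mul0r.
by rewrite E imset_f ?inE in Np.
Qed.

(** The columns of [b] are integral potentials of the [beta i], those of [t] are the bridge
    indicators of the edges of F, all normalised at [v0]. Every integral z is reached: subtracting
    the combination of [t] given by its coboundary on F leaves a coboundary in B^1(G, F), hence an
    integral combination of the [beta i], and connectedness recovers a normalised function from its
    coboundary. *)
Lemma forest_unimodular (beta : 'I_k -> cochain G int) :
  F \in forests G k -> is_Zbasis (B1rel F) beta ->
  exists (b : 'M[int]_(k + s, k)) (t : 'M_(k + s, s)),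
  [/\ forall p i, \sum_j b j i *~ incid (val p) (nu j) = beta i p,
      forall i i', \sum_j t j i' *~ incid (val (f i)) (nu j) = (i == i')%:R
    & row_mx b t \in unitmx].
Proof.
rewrite mem_forests => /and3P[Fs /asboolP Fa _] [bB bZ].
have fF i : val (f i) \in F.
  have : f i \in posedges F by rewrite posedges_family imset_f.
  by rewrite inE.
have [h hE] := choice (fun i => (bB i).1).
pose b : 'M[int]_(k + s, k) := \matrix_(j, i) (h i (nu j) - h i v0).
pose pt i v : int := (potential F (val (f i)) v)%:R.
pose t : 'M[int]_(k + s, s) := \matrix_(j, i) (pt i (nu j) - pt i v0).
have bE p i : \sum_j b j i *~ incid (val p) (nu j) = beta i p.
  under eq_bigr do rewrite mxE.
  rewrite (sum_nu_incid nu_inj nu_v0 nu_surj (f := fun v => h i v - h i v0)).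
    by rewrite hE ffunE opprB addrA addrNK.
  by rewrite subrr.
have tE i i' : \sum_j t j i' *~ incid (val (f i)) (nu j) = (i == i')%:R.
  under eq_bigr do rewrite mxE.
  rewrite (sum_nu_incid nu_inj nu_v0 nu_surj (f := fun v =>
    pt i' v - pt i' v0)).
    rewrite opprB addrA addrNK /pt potential_coboundary //.
    by rewrite (inj_eq f_inj) eq_sym.
  by rewrite subrr.
exists b, t; split=> //.
suff surj (z : 'cV[int]_(k + s)) : exists w, row_mx b t *m w = z.
  have [w wE] := choice (fun j : 'I_(k + s) => surj (delta_mx j 0)).
  have /mulmx1_unit[//] : row_mx b t *m (\matrix_(i, j) w j i 0) = 1%:M.
  apply/matrixP=> i j; have /colP/(_ i) := wE j; rewrite !mxE eqxx andbT => <-.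
  by apply: eq_bigr => l _; rewrite !mxE.
pose y : 'cV[int]_s := \col_i \sum_j z j 0 *~ incid (val (f i)) (nu j).
pose z' := z - t *m y.
pose a : cochain G int := [ffun p => \sum_j z' j 0 *~ incid (val p) (nu j)].
have aB : B1rel F a.
  split.
    exists [ffun v => extend0 nu (fun j => z' j 0) v].
    by apply/ffunP=> p; rewrite !ffunE (sum_incid_extend0 nu_inj nu_v0 nu_surj).
  move=> p pF; have : p \in posedges F by rewrite inE.
  rewrite posedges_family => /imsetP[i _ ->]; rewrite ffunE.
  have zE j : z' j 0 = z j 0 - (t *m y) j 0 by rewrite !mxE.
  under eq_bigr do rewrite zE mulrzBl.
  rewrite sumrB sum_mulmx_int.
  under [X in _ - X]eq_bigr do rewrite tE.
  rewrite (bigD1 i) //= eqxx mul1r [X in _ - (_ +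
    X)]big1 ?addr0 ?mxE ?subrr // => l /negPf nl.
  by rewrite eq_sym nl mul0r.
have [n [nE _]] := bZ _ aB.
exists (col_mx (\col_i n i) y); rewrite mul_row_col.
suff -> : b *m (\col_i n i) = z' by rewrite subrK.
apply/colP=> j; apply/eqP; rewrite -subr_eq0; apply/eqP.
apply: (incid_free nu_inj nu_v0 nu_surj (z := fun j => (b *m (\col_i n i))
  j 0 - z' j 0) hG).
move=> p; under eq_bigr do rewrite mulrzBl.
rewrite sumrB; have /ffunP/(_ p) := nE; rewrite [in LHS]ffunE => ->.
rewrite sum_mulmx_int sum_ffunE -sumrB big1 // => i _.
by rewrite bE mxE ffunMzE mulrzz subrr.
Qed.

(** Multiplication by the unimodular [b, t] preserves |det M|. The incidence rows of F send [b] to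
    0, since the [beta i] vanish on F, and [t] to the identity; what remains is the block U b, the
    transpose of (beta_i(c_j)). *)
Lemma det_forest (beta : 'I_k -> cochain G int) :
  F \in forests G k -> is_Zbasis (B1rel F) beta ->
  `|\det M| ^+ 2 = det_normsq beta c.
Proof.
move=> Ff Fb; have [b [t [bE tE gu]]] := forest_unimodular Ff Fb.
pose gK : 'M[K]_(k + s) := map_mx intr (row_mx b t).
have gK1 : `|\det gK| = 1.
  rewrite det_map_mx; move: gu; rewrite unitmxE => /orP[] /eqP->.
    by rewrite normr1.
  by rewrite rmorphN normrN1.
rewrite /det_normsq -[\det M]mulr1.
transitivity (`|\det (M *m gK)| ^+ 2).
  by rewrite det_mulmx !normrM gK1 normr1.
have rowE n (A : 'M[int]_(k + s, n)) p l :
    \sum_j incid_row p j * (map_mx intr A) j l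
    = (\sum_j A j l *~ incid (val p) (nu j))%:~R.
  rewrite (rmorph_sum (intr : {rmorphism int -> K})).
  by apply: eq_bigr => j _; rewrite mxE mulrzz rmorphM mulrC.
rewrite mul_col_mx /gK map_row_mx !mul_mx_row -[col_mx _ _]/(block_mx _ _ _ _).
have -> : \matrix_(i, j) incid_row (f i) j *m map_mx intr b = 0.
  apply/matrixP=> i a; rewrite mxE; under eq_bigr do rewrite mxE.
  rewrite rowE bE mxE (Fb.1 a).2 //.
  have : f i \in posedges F by rewrite posedges_family imset_f.
  by rewrite inE.
have -> : \matrix_(i, j) incid_row (f i) j *m map_mx intr t = 1%:M.
  apply/matrixP=> i i'; rewrite mxE; under eq_bigr do rewrite mxE.
  by rewrite rowE tE !mxE; case: eqP.
rewrite det_ublock det1 mulr1 -det_tr; congr (`|\det _| ^+ 2).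
apply/matrixP=> i a; rewrite !mxE /pairing.
under eq_bigr do rewrite mxE mulr_suml.
rewrite exchange_big; apply: eq_bigr => p _ /=.
under eq_bigr do rewrite -mulrA.
by rewrite -mulr_sumr rowE bE ffunE mulrC.
Qed.

End FixedFamily.
End Scalars.
End ForestDet.

(** * Forest expansions *)

Section Trees.
Variable G : graph.

Lemma connected_components (S : {set edge G}) : is_subgraph S ->
  connected S = (components S == 1%N).
Proof.
move=> Ss; have Sc := subgraph_connect_sym Ss.
rewrite /components /n_comp_mem; apply/andP/idP.
  case=> /card_gt0P[v0 _] /'forall_forallP hS.
  apply/eqP; rewrite -(card1 (fingraph.root (adj S) v0)); apply: eq_card => v.
  rewrite !inE andbT; apply/eqP/eqP => [<-|->]; last exact: root_root.
  by apply/(fingraph.rootP Sc).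
move=> /eqP/mem_card1[v0 hv0]; split; first by apply/card_gt0P; exists v0.
have rootE v : fingraph.root (adj S) v = v0.
  by have := hv0 (fingraph.root (adj S) v); rewrite !inE roots_root // =>
    /esym/eqP.
by apply/'forall_forallP=> u v; apply/(fingraph.rootP Sc); rewrite !rootE.
Qed.

Lemma spanning_trees_forests : spanning_trees G = forests G 0.
Proof.
apply/setP=> S; rewrite !inE; have [Ss|//] := boolP (is_subgraph S).
by rewrite (connected_components Ss).
Qed.

(** A coboundary that vanishes on a spanning tree comes from a constant function, so B^1(G, F) = 0
    and the empty family is its basis. *)
Lemma Zbasis_tree (F : {set edge G}) (beta : 'I_0 -> cochain G int) :
  F \in forests G 0 -> is_Zbasis (B1rel F) beta.
Proof.
rewrite -spanning_trees_forests inE =>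
  /and3P[Fs _ /andP[_ /'forall_forallP Fc]].
split=> [[]//|a [[h ->] h0]].
have hE : coboundary h = 0.
  apply/ffunP=> p; rewrite !ffunE; apply/eqP; rewrite subr_eq0; apply/eqP.
  apply: connect_const (Fc _ _); apply: subgraph_ind => // [e|p' p'F].
    by rewrite src_einv tgt_einv => ->.
  by have /eqP := h0 _ p'F; rewrite ffunE subr_eq0 => /eqP->.
exists [ffun=> 0]; split; first by rewrite big_ord0.
by move=> n _; apply/ffunP=> -[].
Qed.
End Trees.

Section ForestSum.
Variables (G : graph) (K : numFieldType) (k s : nat) (v0 : vertex G).
Variable nu : 'I_(k + s) -> vertex G.
Hypothesis hG : connected [set: edge G].
Hypothesis nu_inj : injective nu.
Hypothesis nu_v0 : forall i, nu i != v0.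
Hypothesis nu_surj : forall v, v != v0 -> exists i, nu i = v.
Variables (c : 'I_k -> Omega_1 G K) (x : edge G -> K).

Lemma card_posedges_forest F : F \in forests G k -> #|posedges F| = s.
Proof.
rewrite mem_forests => /and3P[Fs /asboolP Fa /eqP Fk].
have := acyclic_card Fs Fa; rewrite Fk (card_vertex_nu nu_inj nu_v0 nu_surj).
by rewrite addnC -addSn => /addnI.
Qed.

Lemma card_injective_families F : F \in forests G k ->
  #|[set f : {ffun 'I_s -> posedge G} | injectiveb f & sym_edges (f @: setT)
    == F]|
  = s`!.
Proof.
move=> Ff; have Fs : is_subgraph F by move: Ff; rewrite mem_forests => /andP[].
have -> : s`! = (#|posedges F| ^_ #|'I_s|)%N.
  by rewrite card_posedges_forest // card_ord ffactnn.
rewrite -card_inj_ffuns_on; apply: eq_card => f.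
rewrite !inE andbC; have [/injectiveP f_inj|] := boolP (injectiveb f);
  rewrite ?andbF //.
rewrite !andbT; apply/eqP/ffun_onP => [<- i|fF].
  by rewrite sym_edgesK imset_f.
rewrite -(posedgesK Fs); congr sym_edges; apply/eqP.
rewrite eqEcard card_imset // cardsT card_ord card_posedges_forest // leqnn
  andbT.
by apply/subsetP=> _ /imsetP[i _ ->].
Qed.

(** Families are grouped by the subgraph they generate. Those with a repetition or outside
    [forests G k] contribute 0, and each forest is met once for each of the s! orderings of its
    positive edges. *)
Lemma forest_sum_ffun (beta : {set edge G} -> 'I_k -> cochain G int) :
  (forall F, F \in forests G k -> is_Zbasis (B1rel F) (beta F)) ->
  forest_sum beta c x *+ s`! =
  \sum_(f : {ffun 'I_s -> posedge G}) (\prod_i x (val (f i))) *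
    `|\det (col_mx (chain_mx nu c) (\matrix_(i, j) incid_row nu K (f i)
      j))| ^+ 2.
Proof.
move=> hbeta; pose F (f : {ffun 'I_s -> posedge G}) := sym_edges (f @: setT).
rewrite [RHS](bigID (fun f : {ffun 'I_s -> posedge G} =>
  injectiveb f && (F f \in forests G k))) /=.
rewrite [X in _ + X]big1 ?addr0; last first.
  move=> f; rewrite negb_and; case: (boolP (injectiveb f)) =>
    [/injectiveP f_inj|f_inj] Ff.
    by rewrite (det_nonforest nu_inj nu_v0 nu_surj) ?normr0 ?expr0n ?mulr0.
  by rewrite det_noninjective ?normr0 ?expr0n ?mulr0.
rewrite (partition_big F (mem (forests G k))) /=; last by move=> f /andP[].
rewrite /forest_sum -sumrMnl; apply: eq_bigr => F0 F0f.
rewrite -(card_injective_families F0f) -sumr_const; apply: eq_big => [f|f].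
  rewrite inE -/(F f) -andbA; case: (F f =P F0) => [->|_];
    last by rewrite !andbF.
  by rewrite F0f.
rewrite inE => /andP[/injectiveP f_inj /eqP Ef].
rewrite mulrC; congr (_ * _).
  have Fs : is_subgraph F0 by move: F0f; rewrite mem_forests => /andP[].
  rewrite (weight_posedges x Fs) -Ef sym_edgesK big_imset /= =>
    [|? ? _ _ /f_inj//].
  by apply: eq_bigl => i; rewrite inE.
by rewrite (det_forest hG nu_inj nu_v0 nu_surj c f_inj (beta := beta F0))
  ?Ef //; apply: hbeta.
Qed.

End ForestSum.

(** * Orthogonal projections *)

(** The real and complex cases are treated together from here on, through a conjugation that is an
    involutive ring morphism with |z|^2 = z cj z. *)
Lemma real_or_complex_conj (R : realType) (K : numFieldType) (conj : K -> K) :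
  real_or_complex R conj ->
  exists cj : {rmorphism K -> K}, [/\ conj = cj, involutive cj &
    forall z, `|z| ^+ 2 = z * cj z].
Proof.
case=> [|{K conj}].
  exists (idfun : {rmorphism R -> R}); split=> // z.
  by rewrite real_normK ?num_real.
exists (@conjc R); split=> //; first exact: conjcK.
exact: sqr_normc.
Qed.

Section Hermitian.
Variables (K : numFieldType) (cj : {rmorphism K -> K}).
Hypothesis cjK : involutive cj.
Hypothesis normE : forall z, `|z| ^+ 2 = z * cj z.

Lemma conj_pos z : 0 < z -> cj z = z.
Proof.
move=> z0; apply: (mulfI (lt0r_neq0 z0)).
by rewrite -normE gtr0_norm // expr2.
Qed.

Definition star m n (A : 'M[K]_(m, n)) : 'M_(n, m) := (map_mx cj A)^T.

Lemma starM m n p (A : 'M[K]_(m, n)) (B : 'M_(n, p)) :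
  star (A *m B) = star B *m star A.
Proof. by rewrite /star map_mxM trmx_mul. Qed.

Lemma starK m n (A : 'M[K]_(m, n)) : star (star A) = A.
Proof. by apply/matrixP=> i j; rewrite !mxE cjK. Qed.

Lemma star_inv n (A : 'M[K]_n) : star (invmx A) = invmx (star A).
Proof. by rewrite /star map_invmx trmx_inv. Qed.

Lemma weighted_sum_eq0 (P : finType) (w y : P -> K) :
  (forall p, 0 < w p) -> \sum_p w p * cj (y p) * y p = 0 -> forall p, y p = 0.
Proof.
move=> w0 /eqP; rewrite psumr_eq0 => [|p _]; last first.
  by rewrite -mulrA [cj _ * _]mulrC -normE mulr_ge0 ?exprn_ge0 // ltW.
move=> /allP y0 p; have := y0 p (mem_index_enum p).
rewrite -mulrA [cj _ * _]mulrC -normE mulf_eq0 gt_eqF //= expf_eq0 /= normr_eq0.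
by move/eqP.
Qed.

(** Positive definiteness: a kernel vector z makes the sum of the nonnegative terms d_i |(A z)_i|^2
    vanish, hence A z = 0. *)
Lemma gram_unit m n (A : 'M[K]_(m, n)) (d : 'rV_m) : (forall i, 0 < d 0 i) ->
  (forall z : 'cV_n, A *m z = 0 -> z = 0) ->
  star A *m diag_mx d *m A \in unitmx.
Proof.
move=> d0 Ainj; rewrite -unitmx_tr unitmxE unitfE; apply/negP=> /det0P[v v0].
move/(congr1 trmx); rewrite trmx_mul trmxK trmx0 => vA.
move/negP: v0; apply; rewrite -[v]trmxK (Ainj v^T) ?trmx0 //.
apply/colP=> i; rewrite [RHS]mxE.
apply: (weighted_sum_eq0 (w := fun i => d 0 i) (y := fun i => (A *m v^T) i 0))
  => //.
transitivity ((star (A *m v^T) *m diag_mx d *m (A *m v^T)) 0 0).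
  rewrite mxE; apply: eq_bigr => j _; rewrite mul_mx_diag !mxE.
  by rewrite [cj _ * _]mulrC.
by rewrite starM !mulmxA -(mulmxA _ (star A)) -(mulmxA _ _ A)
  -(mulmxA (star v^T)) vA mulmx0 mxE.
Qed.

Lemma invmx_diag n (d : 'rV[K]_n) : (forall i, d 0 i != 0) ->
  invmx (diag_mx d) = diag_mx (\row_i (d 0 i)^-1).
Proof.
move=> d0.
have E : diag_mx d *m diag_mx (\row_i (d 0 i)^-1) = 1%:M.
  apply/matrixP=> i j; rewrite mul_mx_diag !mxE mulrnAl.
  by case: eqP => [->|]; rewrite ?mulfV.
by rewrite -[LHS]mulmx1 -E mulKmx //; case/mulmx1_unit: E.
Qed.

Section Orthogonal.
Variables (G : graph) (x : edge G -> K).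
Hypothesis x_gt0 : forall e, 0 < x e.
Local Notation Om := (Omega1 G K).
Implicit Types (a b u : Om) (U : {vspace Om}).

Lemma inner_conj a b : inner cj x b a = cj (inner cj x a b).
Proof.
rewrite rmorph_sum; apply: eq_bigr => e _.
by rewrite !rmorphM cjK (conj_pos (x_gt0 _)) -!mulrA [cj _ * _]mulrC.
Qed.

Lemma inner_eq0C a b : inner cj x a b = 0 -> inner cj x b a = 0.
Proof. by rewrite [inner _ _ b a]inner_conj => ->; rewrite rmorph0. Qed.

Lemma inner_definite a : inner cj x a a = 0 -> a = 0.
Proof.
move=> a0; apply/ffunP=> e; rewrite ffunE.
exact: (weighted_sum_eq0 (fun p : posedge G => x_gt0 (val p)) a0).
Qed.

Lemma orthcP U a :
  reflect (forall u, u \in U -> inner cj x u a = 0) (a \in orthc cj x U).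
Proof.
rewrite memv_ker lfunE /=; apply: (iffP eqP) => [/rowP a0 u uU|a0].
  apply: inner_eq0C; rewrite (coord_vbasis uU) linear_sum big1 // => i _.
  rewrite linearZ /= inner_eq0C ?scaler0 //.
  by have := a0 i; rewrite !mxE.
by apply/rowP=> i; rewrite !mxE a0 // vbasis_mem // mem_nth ?size_tuple.
Qed.

Lemma orthc_cap U : (U :&: orthc cj x U = 0)%VS.
Proof.
apply/eqP; rewrite -subv0; apply/subvP=> a; rewrite memv_cap memv0.
case/andP=> aU /orthcP/(_ _ aU) a0; apply/eqP; exact: inner_definite.
Qed.

Lemma dim_Omega1 : \dim {: Om} = #|{: posedge G}|.
Proof. by rewrite dimvf /dim /= muln1. Qed.

Lemma orthc_dim U : (\dim (orthc cj x U) + \dim U)%N = #|{: posedge G}|.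
Proof.
apply/eqP; rewrite eqn_leq; apply/andP; split.
  rewrite addnC -dimv_disjoint_sum ?orthc_cap // -dim_Omega1.
  exact/dimvS/subvf.
have := limg_ker_dim (linfun (inner_basis cj x U)) fullv.
rewrite capfv dim_Omega1 => <-; rewrite leq_add2l.
apply: leq_trans (dimvS (subvf _)) _.
by rewrite dimvf /dim /= mul1n.
Qed.

Lemma orthc_add U : (U + orthc cj x U = fullv)%VS.
Proof.
apply/eqP; rewrite eqEdim subvf dimv_disjoint_sum ?orthc_cap //.
by rewrite /= addnC orthc_dim dim_Omega1.
Qed.

Lemma orth_proj_mem U a : orth_proj cj x U a \in U.
Proof. exact: memv_pi. Qed.

Lemma orth_projP U a u : u \in U -> inner cj x u (orth_proj cj x U a)
  = inner cj x u a.
Proof.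
move=> uU; have aF : a \in (U + orthc cj x U)%VS by rewrite orthc_add memvf.
rewrite -[in RHS](daddv_pi_add (orthc_cap U) aF) linearD /=.
have /orthcP/(_ _ uU) -> := memv_pi (orthc cj x U) U a.
by rewrite addr0.
Qed.

End Orthogonal.

(** * Q as the orthogonal complement of im d *)

Section Cycles.
Variable G : graph.
Local Notation Om := (Omega1 G K).

Lemma coboundaryE (f : Omega_0 G K) p :
  coboundary f p = \sum_v f v * (incid (val p) v)%:~R.
Proof.
by rewrite ffunE -sum_incid; apply: eq_bigr => v _; rewrite mulrzr.
Qed.

Lemma boundaryE (z : Omega_1 G K) v :
  boundary z v = \sum_p z p * (incid (val p) v)%:~R.
Proof.
rewrite ffunE.
under [RHS]eq_bigr do rewrite rmorphB mulrBr.
rewrite sumrB; congr (_ - _); rewrite big_mkcond; apply: eq_bigr => p _;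
  by case: eqP; rewrite ?mulr1 ?mulr0.
Qed.

Lemma im_dP (a : Om) :
  reflect (exists f : Omega_0 G K, a = coboundary f) (a \in im_d G K).
Proof.
apply: (iffP memv_imgP) => [[f _ ->]|[f ->]]; first by exists f; rewrite lfunE.
by exists f; rewrite ?memvf ?lfunE.
Qed.

(** The pairing of d f with a chain z is that of f with the boundary of z, so images of cycles are
    orthogonal to im d. Conversely, testing a against coboundaries of indicators of vertices shows
    that the conjugate of a is a cycle. *)
Lemma Qspace_orthc : Qspace G cj = orthc cj (unit_weight G K) (im_d G K).
Proof.
have w0 e : 0 < unit_weight G K e by apply: ltr01.
apply/eqP; rewrite eqEsubv; apply/andP; split.
  apply/span_subvP=> _ /mapP[z /vbasis_mem zZ ->].
  apply/(orthcP w0)=> _ /im_dP[f ->].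
  have {}zZ : boundary z = 0 by move: zZ; rewrite memv_ker lfunE => /eqP.
  transitivity (cj (\sum_p coboundary f p * z p)).
    rewrite rmorph_sum; apply: eq_bigr => p _.
    by rewrite [J1 _ _ _ _]ffunE divr1 mul1r rmorphM.
  under eq_bigr do rewrite coboundaryE mulr_suml.
  rewrite exchange_big big1 ?rmorph0 // => v _ /=.
  transitivity (f v * boundary z v); last by rewrite zZ ffunE mulr0.
  rewrite boundaryE mulr_sumr; apply: eq_bigr => p _; ring.
apply/subvP=> a /(orthcP w0) a0.
pose z : Omega_1 G K := [ffun p => cj (a p)].
have zZ : z \in Z1K G K.
  rewrite memv_ker lfunE; apply/eqP/ffunP=> v; rewrite boundaryE [RHS]ffunE.
  have /im_dP/a0 : exists f, coboundary [ffun u =>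
    (u == v)%:R : K^o] = coboundary f.
    by eexists.
  move/(congr1 cj); rewrite rmorph0 rmorph_sum => E; rewrite -[RHS]E.
  apply: eq_bigr => p _; rewrite [z p]ffunE !rmorphM cjK rmorph1 mul1r mulrC.
  congr (_ * _); rewrite coboundaryE (bigD1 v)
    //= ffunE eqxx mul1r big1 ?addr0 //.
  by move=> u /negPf nu; rewrite ffunE nu mul0r.
(* [J1] is antilinear, so the coordinates of z in the basis of cycles get conjugated. *)
have -> : a = \sum_i cj (coord (vbasis (Z1K G K)) i z)
  *: J1 cj (unit_weight G K) (vbasis (Z1K G K))`_i.
  apply/ffunP=> p; rewrite sum_ffunE -[LHS]cjK.
  have -> : cj (a p) = z p by rewrite ffunE.
  rewrite {1}(coord_vbasis zZ) sum_ffunE rmorph_sum; apply: eq_bigr => i _.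
  by rewrite !ffunE rmorphM divr1.
apply: memv_suml => i _; apply/memvZ/memv_span/map_f.
by rewrite mem_nth ?size_tuple.
Qed.

End Cycles.
End Hermitian.

(** * The three determinants *)

Lemma sum_enum_val (A : nmodType) (P : finType) (F : P -> A) :
  \sum_p F p = \sum_(i < #|P|) F (enum_val i).
Proof. by rewrite (reindex _ (onW_bij _ (enum_val_bij P))). Qed.

(** [detE] is computed in the chosen basis of W; the coordinates [phi] differ from it by the
    invertible matrix T, which conjugates the matrix of f to M. *)
Lemma detE_mx (K : numFieldType) (W : vectType K) n (f : 'End(W))
    (phi : {linear W -> 'rV[K]_n}) (M : 'M_n) :
  injective phi -> \dim {: W} = n ->
  (forall w, phi (f w) = phi w *m M) -> detE f = \det M.
Proof.
move=> phi_inj dimW; case: n / dimW phi M phi_inj => phi M phi_inj phif.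
pose b := vbasis {: W}.
pose T := \matrix_(i < \dim {: W}) phi b`_i.
have vecofK : cancel (passmx.rVof b) (passmx.vecof b)
  by apply: passmx.rVofK (vbasisP _).
have TE v : phi (passmx.vecof b v) = v *m T.
  rewrite mulmx_sum_row linear_sum; apply: eq_bigr => i _.
  by rewrite linearZ rowK.
have Tu : T \in unitmx.
  rewrite -row_free_unit -kermx_eq0; apply/rowV0P=> v /sub_kermxP.
  rewrite -TE => h; have : passmx.vecof b v = 0.
    by apply: phi_inj; rewrite h linear0.
  by move/eqP; rewrite (passmx.vecof_eq0 (vbasisP _)) => /eqP.
have FT : passmx.mxof b b f *m T = T *m M.
  apply/row_matrixP=> i; rewrite !rowE !mulmxA -!TE -phif.
  by rewrite passmx.mul_mxof vecofK.
have dT : \det T != 0 by rewrite -unitfE -unitmxE.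
by apply: (mulIf dT); rewrite /detE -det_mulmx FT det_mulmx mulrC.
Qed.

Lemma colM (R : pzSemiRingType) m n p (A : 'M[R]_(m, n)) (B : 'M_(n, p)) j :
  col j (A *m B) = A *m col j B.
Proof. by rewrite !colE mulmxA. Qed.

Lemma row_mul_col (R : pzSemiRingType) m n p (A : 'M[R]_(m, n))
    (B : 'M_(n, p)) i j :
  (row i A *m col j B) 0 0 = (A *m B) i j.
Proof. by rewrite !mxE; apply: eq_bigr => l _; rewrite !mxE. Qed.

Lemma star_col (K : numFieldType) (cj : {rmorphism K -> K}) m n
    (A : 'M[K]_(m, n)) i :
  star cj (col i A) = row i (star cj A).
Proof. by apply/rowP=> j; rewrite !mxE. Qed.

Section Reduced.
Variables (K : numFieldType) (cj : {rmorphism K -> K}).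
Hypothesis cjK : involutive cj.
Hypothesis normE : forall z, `|z| ^+ 2 = z * cj z.
Variables (G : graph) (x : edge G -> K).
Hypothesis hG : connected [set: edge G].
Hypothesis x_gt0 : forall e, 0 < x e.
Variables (k s : nat) (v0 : vertex G) (nu : 'I_(k + s) -> vertex G).
Hypothesis nu_inj : injective nu.
Hypothesis nu_v0 : forall i, nu i != v0.
Hypothesis nu_surj : forall v, v != v0 -> exists i, nu i = v.
Variable c : 'I_k -> Omega_1 G K.

Local Notation m := #|{: posedge G}|.
Local Notation one := (unit_weight G K).

Definition weight_row (y : edge G -> K) : 'rV[K]_m :=
  \row_i y (val (enum_val i)).
Definition incid_mx : 'M[K]_(m, k + s) :=
  \matrix_(i, j) incid_row nu K (enum_val i) j.
Definition laplacian (y : edge G -> K) : 'M[K]_(k + s) :=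
  incid_mx^T *m diag_mx (weight_row y) *m incid_mx.
Definition col_cochain (a : Omega1 G K) : 'cV[K]_m := \col_i a (enum_val i).
Definition chain_rows : 'M[K]_(k, m) := \matrix_(i, e) c i (enum_val e).

Local Notation D := incid_mx.
Local Notation L := (laplacian x).
Local Notation U := (chain_mx nu c).

Lemma star_incid_mx : star cj D = D^T.
Proof. by apply/matrixP=> i j; rewrite !mxE rmorph_int. Qed.

Lemma chain_rowsM : chain_rows *m D = U.
Proof.
apply/matrixP=> i j; rewrite !mxE [RHS]sum_enum_val.
by apply: eq_bigr => e _; rewrite !mxE.
Qed.

Lemma laplacian_sum (y : edge G -> K) :
  laplacian y = \matrix_(i, j) \sum_p (y (val p) * incid_row nu K p i) *
    incid_row nu K p j.
Proof.
apply/matrixP=> i j; rewrite !mxE [RHS]sum_enum_val.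
by apply: eq_bigr => e _; rewrite mul_mx_diag !mxE [_ * y _]mulrC.
Qed.

Lemma incid_mx_inj (z : 'cV[K]_(k + s)) : D *m z = 0 -> z = 0.
Proof.
move=> Dz; apply/colP=> j; rewrite [RHS]mxE.
apply: (incid_free nu_inj nu_v0 nu_surj (z := fun j => z j 0) hG) => p.
have /colP/(_ (enum_rank p)) := Dz; rewrite [RHS]mxE => E; rewrite -[RHS]E mxE.
by apply: eq_bigr => i _; rewrite !mxE enum_rankK mulrC mulrzr.
Qed.

Lemma laplacian_unit (y : edge G -> K) : (forall e, 0 < y e) ->
  laplacian y \in unitmx.
Proof.
move=> y0; rewrite /laplacian -star_incid_mx; apply: (gram_unit normE).
  by move=> i; rewrite mxE.
exact: incid_mx_inj.
Qed.

Lemma star_laplacian : star cj L = L.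
Proof.
have DtE : star cj D^T = D by rewrite -star_incid_mx (starK cjK).
rewrite /laplacian !starM star_incid_mx DtE mulmxA; congr (_ *m _ *m _).
apply/matrixP=> i j; rewrite !mxE rmorphMn /=.
by rewrite (conj_pos normE) // eq_sym; case: eqP => [->|].
Qed.

(** Bordered Cauchy-Binet is applied with weighted incidence rows below the conjugate of U on one
    side and plain rows below U on the other. Each term is then x^F |det M|^2, and the factor s!
    cancels. *)
Lemma forest_sum_det (beta : {set edge G} -> 'I_k -> cochain G int) :
  (forall F, F \in forests G k -> is_Zbasis (B1rel F) (beta F)) ->
  forest_sum beta c x = \det L * \det (U *m invmx L *m star cj U).
Proof.
move=> hbeta; have Lu := laplacian_unit x_gt0.
apply: (pmulrnI (fact_gt0 s)).
rewrite /star; rewrite laplacian_sum in Lu *.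
rewrite (forest_sum_ffun hG nu_inj nu_v0 nu_surj c x hbeta)
  -(bordered_cauchy_binet _ _ Lu).
apply: eq_bigr => f _.
set M := col_mx U _; rewrite [RHS]mulrC normE mulrCA; congr (_ * _).
rewrite -det_map_mx.
(* Incidence entries are integers, hence fixed by conjugation, so a diagonal matrix of weights turns
   the conjugate of M into the other bordered matrix. *)
transitivity (\det (block_mx 1%:M 0 0 (diag_mx (\row_i x (val (f i))))
  *m map_mx cj M)).
  rewrite det_mulmx det_ublock det1 mul1r det_diag; congr (_ * _).
  by apply: eq_bigr => i _; rewrite mxE.
rewrite map_col_mx mul_block_col !mul1mx !mul0mx addr0 add0r;
  congr (\det (col_mx _ _)).
by apply/matrixP=> i j; rewrite mul_diag_mx !mxE rmorph_int.
Qed.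

Lemma innerE (y : edge G -> K) a b :
  inner cj y a b = (star cj (col_cochain a) *m diag_mx (weight_row y)
    *m col_cochain b) 0 0.
Proof.
rewrite mxE /inner sum_enum_val; apply: eq_bigr => e _.
by rewrite mul_mx_diag !mxE [y _ * _]mulrC.
Qed.

(** The coboundary of the indicator of [nu j]; these cochains form a basis of im d. *)
Definition incid_cochain j : Omega1 G K := [ffun p => incid_row nu K p j].

Lemma incid_cochain_im_d j : incid_cochain j \in im_d G K.
Proof.
apply/im_dP; exists [ffun v => (v == nu j)%:R : K^o].
apply/ffunP=> p; rewrite coboundaryE !ffunE (bigD1 (nu j)) //= ffunE eqxx mul1r.
rewrite big1 ?addr0 // => v /negPf nv; by rewrite ffunE nv mul0r.
Qed.

Lemma im_d_coords a : a \in im_d G K ->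
  exists y : 'cV_(k + s), a = \sum_j y j 0 *: incid_cochain j.
Proof.
case/im_dP=> f ->; exists (\col_j (f (nu j) - f v0)).
apply/ffunP=> p; rewrite ffunE sum_ffunE.
have := sum_nu_incid nu_inj nu_v0 nu_surj (f := fun v => f v - f v0) (val p)
  (subrr _).
rewrite opprB addrA addrNK => <-.
by apply: eq_bigr => j _; rewrite !ffunE mxE -mulrzr.
Qed.

Lemma col_cochain_comb (y : 'cV_(k + s)) :
  col_cochain (\sum_j y j 0 *: incid_cochain j) = D *m y.
Proof.
apply/colP=> e; rewrite !mxE sum_ffunE; apply: eq_bigr => j _.
by rewrite !ffunE mxE mulrC.
Qed.

Lemma col_cochain_inj : injective col_cochain.
Proof.
move=> a b /colP E; apply/ffunP=> p.
by have := E (enum_rank p); rewrite !mxE enum_rankK.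
Qed.

Lemma dim_im_d : \dim (im_d G K) = (k + s)%N.
Proof.
pose X := [tuple incid_cochain j | j < k + s].
have XE (j : 'I_(k + s)) : X`_j = incid_cochain j by rewrite -tnth_nth
  tnth_mktuple.
apply: (@size_basis _ _ _ _ X); apply/andP; split.
  rewrite eqEsubv; apply/andP; split.
    by apply/span_subvP=> _ /mapP[j _ ->]; apply: incid_cochain_im_d.
  apply/subvP=> a /im_d_coords[y ->]; apply: memv_suml => j _.
  by apply/memvZ/memv_span/mapP; exists j; rewrite ?mem_enum.
apply/freeP=> y; under eq_bigr do rewrite XE.
move=> y0 i; have E : D *m (\col_i y i) = 0.
  rewrite -col_cochain_comb; under eq_bigr do rewrite mxE.
  by rewrite y0; apply/colP=> e; rewrite !mxE ffunE.
by have /colP/(_ i) := incid_mx_inj E; rewrite !mxE.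
Qed.

(** Let Y hold the coordinates of the projections in the basis of columns of D. Testing against that
    basis gives the normal equations L Y = U^*, the weight in the inner product cancelling the one
    in [J1]. The Gram matrix Y^* L Y is then U L^-1 U^*. *)
Lemma wedge_normsq_det :
  wedge_normsq cj x (fun i => orth_proj cj x (im_d G K) (J1 cj x (c i)))
  = \det (U *m invmx L *m star cj U).
Proof.
have Lu := laplacian_unit x_gt0.
pose P i := orth_proj cj x (im_d G K) (J1 cj x (c i)).
have [y yE] := choice (fun i => im_d_coords (orth_proj_mem cj x (im_d G K)
  (J1 cj x (c i)))).
pose Y := \matrix_(j, i) y i j 0.
have YE i : col_cochain (P i) = D *m col i Y.
  by rewrite /P yE col_cochain_comb; congr (_ *m _); apply/colP=> j;
    rewrite !mxE.
have incidE j : col_cochain (incid_cochain j) = col j D.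
  by apply/colP=> e; rewrite !mxE ffunE.
have LY : L *m Y = star cj U.
  apply/matrixP=> j i.
  have := orth_projP cjK normE x_gt0 (J1 cj x (c i)) (incid_cochain_im_d j).
  rewrite -/(P i) innerE YE incidE => E.
  transitivity ((star cj (col j D) *m diag_mx (weight_row x)
    *m (D *m col i Y)) 0 0).
    by rewrite star_col star_incid_mx -colM -row_mul row_mul_col mulmxA.
  rewrite E !mxE rmorph_sum; apply: eq_bigr => p _.
  rewrite !ffunE rmorphM !rmorph_int.
  by field; rewrite gt_eqF.
have EY : Y = invmx L *m star cj U by rewrite -LY mulKmx.
rewrite /wedge_normsq /wedge_inner.
have -> : \matrix_(i, j) inner cj x (P i) (P j) = star cj Y *m L *m Y.
  apply/matrixP=> i j; rewrite mxE innerE !YE -!(colM D)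
    star_col -row_mul row_mul_col.
  by rewrite starM star_incid_mx /laplacian !mulmxA.
rewrite EY starM star_inv star_laplacian (starK cjK).
by rewrite mulmxKV // mulmxA.
Qed.

(** * The determinant of b composed with its adjoint *)

Local Notation Q := (Qspace G cj).
Local Notation l := (\dim Q).
Local Notation W := (QKk G cj k).

Definition Qmx : 'M[K]_(m, l) := \matrix_(e, i) (vbasis Q)`_i (enum_val e).

Local Notation q := Qmx.
Local Notation X := (diag_mx (weight_row x)).

Definition QKk_coords (w : W) : 'rV[K]_(l + k) :=
  row_mx (\row_i coord (vbasis Q) i (vsval w.1)) w.2.

Lemma QKk_coords_is_linear : linear QKk_coords.
Proof.
move=> t w w'; rewrite /QKk_coords scale_row_mx add_row_mx; congr row_mx.
by apply/rowP=> i; rewrite !mxE !linearP.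
Qed.

HB.instance Definition _ :=
  GRing.isLinear.Build K W 'rV[K]_(l + k) _ QKk_coords QKk_coords_is_linear.

Lemma Qmx_col (u : Omega1 G K) : u \in Q ->
  col_cochain u = q *m (\row_i coord (vbasis Q) i u)^T.
Proof.
move=> uQ; apply/colP=> e; rewrite !mxE {1}(coord_vbasis uQ) sum_ffunE.
by apply: eq_bigr => i _; rewrite !ffunE !mxE mulrC.
Qed.

Lemma QKk_coords_inj : injective QKk_coords.
Proof.
move=> w w' /eq_row_mx[E1 E2]; apply: injective_projections => //.
apply/val_inj/col_cochain_inj.
by rewrite !Qmx_col ?subvsP // E1.
Qed.

Lemma dim_QKk : \dim {: W} = (l + k)%N.
Proof.
rewrite dimvf -[dim W]/(dim (subvs_of Q) + dim 'rV[K]_k)%N dim_matrix mul1r.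
by [].
Qed.

Lemma Qmx_inj (z : 'cV[K]_l) : q *m z = 0 -> z = 0.
Proof.
move=> qz; have /freeP := basis_free (vbasisP Q).
move=> /(_ (fun i => z i 0)) H; apply/colP=> i; rewrite [RHS]mxE; apply: H.
apply: col_cochain_inj; rewrite -[RHS](_ : q *m z = _); last first.
  by rewrite qz; apply/colP=> e; rewrite !mxE ffunE.
by apply/colP=> e; rewrite !mxE sum_ffunE; apply: eq_bigr => j _;
  rewrite !ffunE mulrC !mxE.
Qed.

Lemma star_Qmx_incid : star cj q *m D = 0.
Proof.
apply/matrixP=> i j; rewrite [RHS]mxE.
have w0 e : 0 < one e by apply: ltr01.
have uQ : (vbasis Q)`_i \in Q by rewrite vbasis_mem // mem_nth ?size_tuple.
transitivity (inner cj one (vbasis Q)`_i (incid_cochain j)).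
  rewrite mxE /inner [RHS]sum_enum_val; apply: eq_bigr => e _.
  by rewrite !mxE !ffunE mul1r.
apply: (inner_eq0C cjK normE w0); move: _`_i uQ => u;
  rewrite (Qspace_orthc cjK normE).
by move/(orthcP cjK normE w0); apply; apply: incid_cochain_im_d.
Qed.

Lemma gram_Qmx_unit : star cj q *m q \in unitmx.
Proof.
have := gram_unit (A := q) (d := const_mx 1) normE.
rewrite diag_const_mx mulmx1; apply; last exact: Qmx_inj.
by move=> i; rewrite mxE ltr01.
Qed.

Lemma weight_mx_unit : X \in unitmx.
Proof.
rewrite unitmxE det_diag unitfE; apply/prodf_neq0=> i _.
by rewrite mxE gt_eqF.
Qed.

(** The basis of Q need not be orthonormal, so its Gram matrix enters. In coordinates the adjoint is
    X^-1 [q, conj C] by [colW], and b is the inverse of [Gb] times [q^*; C^T] by [colB]. *)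
Lemma detE_b (bstar : 'Hom(W, Omega1 G K)) :
  is_adjoint x (b_map cj c) bstar ->
  \det (star cj q *m q) * detE (b_map cj c \o bstar)%VF =
  \det (col_mx (star cj q) chain_rows *m invmx X *m row_mx q (star cj
    chain_rows)).
Proof.
move=> bP; pose B0 := row_mx q (star cj chain_rows); pose B1 :=
  col_mx (star cj q) chain_rows.
have w0 e : 0 < one e by apply: ltr01.
have colW w : X *m col_cochain (bstar w) = B0 *m (QKk_coords w)^T.
  rewrite tr_row_mx mul_row_col -Qmx_col ?subvsP //.
  apply/colP=> e; rewrite mul_diag_mx !mxE.
  (* Testing adjointness against the indicator of one edge reads off a single coordinate of
     [bstar w]. *)
  pose de : Omega1 G K := [ffun p => (p == enum_val e)%:R].
  have sum_de (F : posedge G -> K) : \sum_p de p * F p = F (enum_val e).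
    rewrite (bigD1 (enum_val e)) //= ffunE eqxx mul1r big1 ?addr0 // =>
      p /negPf np.
    by rewrite ffunE np mul0r.
  have cj_de p : cj (de p) = de p by rewrite ffunE rmorph_nat.
  have := bP de w; rewrite lfunE /inner_QKk /=.
  rewrite vsprojK ?orth_proj_mem //.
  have -> : inner cj one (orth_proj cj one Q de) (vsval w.1)
    = vsval w.1 (enum_val e).
    rewrite (inner_conj cjK normE w0) (orth_projP cjK normE w0) ?subvsP //.
    rewrite -(inner_conj cjK normE w0) -[RHS](sum_de (fun p => vsval w.1 p)).
    by apply: eq_bigr => p _; rewrite cj_de mul1r.
  have -> : inner cj x de (bstar w) = x (val (enum_val e)) *
    bstar w (enum_val e).
    rewrite -[RHS](sum_de (fun p => x (val p) * bstar w p)).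
    by apply: eq_bigr => p _; rewrite cj_de; ring.
  move=> <-; congr (_ + _); apply: eq_bigr => i _.
  by rewrite !mxE /pairing sum_de.
have colB a : block_mx (star cj q *m q)
  0 0 1%:M *m (QKk_coords (b_map cj c a))^T
    = B1 *m col_cochain a.
  rewrite lfunE tr_row_mx mul_block_col mul_col_mx !mul0mx mul1mx addr0 add0r
    /=.
  congr col_mx.
    rewrite -mulmxA -Qmx_col ?subvsP // vsprojK ?orth_proj_mem //.
    apply/colP=> i.
    have uQ : (vbasis Q)`_i \in Q by rewrite vbasis_mem // mem_nth ?size_tuple.
    have H b : (star cj q *m col_cochain b) i 0 = inner cj one (vbasis Q)`_i b.
      rewrite mxE /inner [RHS]sum_enum_val; apply: eq_bigr => e _.
      by rewrite !mxE mul1r.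
    by rewrite !H (orth_projP cjK normE w0).
  apply/colP=> i; rewrite !mxE /pairing sum_enum_val.
  by apply: eq_bigr => e _; rewrite !mxE mulrC.
pose Gb := block_mx (star cj q *m q) 0 0 (1%:M : 'M_k).
have detGb : \det Gb = \det (star cj q *m q) by rewrite det_ublock det1 mulr1.
have Gbu : Gb \in unitmx by rewrite unitmxE detGb -unitmxE gram_Qmx_unit.
rewrite (@detE_mx _ _ _ _ QKk_coords (invmx Gb *m (B1 *m invmx X *m B0))^T).
- by rewrite det_tr -detGb -det_mulmx mulKVmx.
- exact: QKk_coords_inj.
- exact: dim_QKk.
move=> w; apply: trmx_inj; rewrite trmx_mul trmxK comp_lfunE.
apply: (can_inj (mulKmx Gbu)); rewrite colB !mulmxA mulmxV // mul1mx.
by rewrite -[RHS]mulmxA -colW -!mulmxA (mulKmx weight_mx_unit).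
Qed.

(** [det_schur_dual] applies because the columns of q and of D are orthogonal for the unit weights
    and their numbers add up to |E^+|. The common factor det (q^* q) is then cancelled. *)
Lemma tree_laplacian_b (bstar : 'Hom(W, Omega1 G K)) :
  is_adjoint x (b_map cj c) bstar ->
  \det L * \det (U *m invmx L *m star cj U) =
  \det (laplacian one) * \det X * detE (b_map cj c \o bstar)%VF.
Proof.
move=> bP; have w0 e : 0 < one e by apply: ltr01.
have E1 : laplacian one = D^T *m D.
  rewrite /laplacian.
  have -> : weight_row one = const_mx 1 by apply/rowP=> i; rewrite !mxE.
  by rewrite diag_const_mx mulmx1.
have Dq : D^T *m q = 0.
  by rewrite -star_incid_mx -[q](starK cjK)
    -starM star_Qmx_incid /star map_mx0 trmx0.
have dG : \det (star cj q *m q) != 0 by rewrite -unitfE -unitmxE gram_Qmx_unit.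
apply: (mulfI dG); rewrite [RHS]mulrCA (detE_b bP) E1.
have Em : (l + (k + s) = m)%N.
  by rewrite -dim_im_d (Qspace_orthc cjK normE) (orthc_dim cjK normE w0).
rewrite (det_schur_dual _ _ Em star_Qmx_incid Dq weight_mx_unit).
- suff -> : D^T *m star cj chain_rows = star cj U by rewrite chain_rowsM.
  by rewrite -star_incid_mx -starM chain_rowsM.
- rewrite invmx_diag => [|i]; last by rewrite mxE gt_eqF.
  apply: (gram_unit normE); last exact: Qmx_inj.
  by move=> i; rewrite !mxE invr_gt0.
exact: laplacian_unit.
Qed.

Lemma weight_det : weight x [set: edge G] = \det X.
Proof.
have Es : is_subgraph [set: edge G] by apply/'forall_implyP=> e; rewrite !inE.
rewrite (weight_posedges x Es)
  det_diag (reindex _ (onW_bij _ (enum_val_bij (posedge G)))).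
by apply: eq_big => i; rewrite ?inE ?mxE.
Qed.

End Reduced.

(** This is the forest expansion for k = 0, where the border has no rows and the determinants of
    size 0 equal 1. *)
Lemma tree_sum_det (K : numFieldType) (cj : {rmorphism K -> K})
    (normE : forall z, `|z| ^+ 2 = z * cj z) (G : graph) (y : edge G -> K)
    (r : nat) (v0 : vertex G) (nu : 'I_r -> vertex G) :
  connected [set: edge G] -> (forall e, 0 < y e) -> injective nu ->
  (forall i, nu i != v0) -> (forall v, v != v0 -> exists i, nu i = v) ->
  tree_sum y = \det (laplacian (k := 0) nu y).
Proof.
move=> hG y0 nu_inj nu_v0 nu_surj.
pose c (i : 'I_0) : Omega_1 G K := 0;
pose beta (F : {set edge G}) (i : 'I_0) : cochain G int := 0.
have := forest_sum_det (k := 0) normE hG y0 nu_inj nu_v0 nu_surj c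
  (beta := beta) (fun F => @Zbasis_tree G F (beta F)).
rewrite det_mx00 mulr1 => <-; rewrite /tree_sum spanning_trees_forests.
by apply: eq_bigr => F _; rewrite /det_normsq det_mx00 normr1 expr1n mul1r.
Qed.

Lemma enumerate_nonroot (T : finType) (v0 : T) (r : nat) : #|T| = r.+1 ->
  exists nu : 'I_r -> T, [/\ injective nu, forall i, nu i != v0
    & forall v, v != v0 -> exists i, nu i = v].
Proof.
move=> cT; have cA : #|[pred v | v != v0]| = r.
  by have := cardC1 v0; rewrite cT /= => <-; apply: eq_card => v; rewrite !inE.
exists (fun i => enum_val (cast_ord (esym cA) i)); split.
- by move=> i j /enum_val_inj/cast_ord_inj.
- by move=> i; have := enum_valP (cast_ord (esym cA) i); rewrite inE.
move=> v vv0; exists (cast_ord cA (enum_rank_in (vv0 : v \in [pred v | v != v0])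
  v)).
by rewrite cast_ordK enum_rankK_in.
Qed.

Unset Implicit Arguments.

Theorem proposition8p4 (R : realType) (K : numFieldType) (conj : K -> K)
  (hK : real_or_complex R conj)
  (G : graph) (hG : connected [set: edge G])
  (x : edge G -> K) (x_gt0 : forall e, 0 < x e)
  (x_inv : forall e, x (einv e) = x e)
  (k : nat) (c : 'I_k -> Omega_1 G K)
  (hH : (\dim (Hspace c) + k + 1)%N = #|vertex G|)
  (beta : {set edge G} -> 'I_k -> cochain G int)
  (hbeta : forall F, F \in forests G k -> is_Zbasis (B1rel F) (beta F))
  (bstar : 'Hom(QKk G conj k, Omega1 G K))
  (hbstar : is_adjoint x (b_map conj c) bstar) :
  forest_sum beta c x
    = tree_sum x
      * wedge_normsq conj x (fun i => orth_proj conj x (im_d G K) (J1 conj x (c i)))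
  /\
  tree_sum x
      * wedge_normsq conj x (fun i => orth_proj conj x (im_d G K) (J1 conj x (c i)))
    = tree_sum (unit_weight G K) * weight x [set: edge G]
      * detE (b_map conj c \o bstar)%VF.
Proof.
have [cj [conjE cjK normE]] := real_or_complex_conj hK.
rewrite {hK}conjE in bstar hbstar *.
have /card_gt0P[v0 _] := proj1 (andP hG).
(* The hypothesis on H allows s = dim H, so that the non-root vertices are indexed by ['I_(k + s)],
   as a border of k rows requires. *)
have cV : #|vertex G| = (k + \dim (Hspace c)).+1 by rewrite -hH addn1 addnC.
have [nu [nu_inj nu_v0 nu_surj]] := enumerate_nonroot v0 cV.
have w0 e : 0 < unit_weight G K e by apply: ltr01.
rewrite (wedge_normsq_det cjK normE hG x_gt0 nu_inj nu_v0 nu_surj).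
rewrite !(tree_sum_det normE hG _ nu_inj nu_v0 nu_surj) //.
rewrite (forest_sum_det normE hG x_gt0 nu_inj nu_v0 nu_surj c hbeta).
split=> //.
rewrite weight_det.
exact: (tree_laplacian_b cjK normE hG x_gt0 nu_inj nu_v0 nu_surj).
Qed.
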